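(* Let $(g,h)$ and $(g',h')$ be two constraint map-germs $(\mathbb R^n,0)\to\mathbb R^q\times\mathbb R^r$ whose feasible set-germs are non-empty. Suppose that $(g,h)$ and $(g',h')$ are finitely $\mathcal K[G]$-determined and $\mathcal K[G]$-equivalent. Then any reductions $(g,h)_{\iota_{(i)},(k)}$ and $(g',h')_{\iota_{(i')},(k')}$ having the same number of inequality constraints and the same number of equality constraints are $\mathcal K[G]$-equivalent.
   Context: A constraint map-germ is a smooth map-germ $(g,h):(\mathbb R^n,0)\to\mathbb R^q\times\mathbb R^r$ with $h(0)=0$; its feasible set-germ is the germ at $0$ of $\{x: g_i(x)\le0\ \forall i,\ h_j(x)=0\ \forall j\}$; it is non-empty iff $g_j(0)\le0$ for all $j$. $\mathcal K[G]$-equivalence: two constraint map-germs $(g,h),(g',h')$ with the same source dimension $n$ and the same $q,r$ are $\mathcal K[G]$-equivalent if there are a diffeomorphism-germ $\Phi:(\mathbb R^n,0)\to(\mathbb R^n,0)$ and smooth germs at $0\in\mathbb R^n$ of matrix-valued maps $C$ ($q\times q$, each $C(x)$ a product of a diagonal matrix with positive diagonal entries and a permutation matrix), $B$ ($q\times r$, arbitrary), $A$ ($r\times r$, each $A(x)$ invertible) with $g(x)=C(x)g'(\Phi^{-1}(x))+B(x)h'(\Phi^{-1}(x))$ and $h(x)=A(x)h'(\Phi^{-1}(x))$. A constraint map-germ is $m$-$\mathcal K[G]$-determined if every constraint map-germ with the same $m$-jet at $0$ is $\mathcal K[G]$-equivalent to it, and finitely $\mathcal K[G]$-determined if it is $m$-$\mathcal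 K[G]$-determined for some $m\in\mathbb N$. Reduction: let $(k)=(k_1,\dots,k_{q-s})$ be a set of indices in $\{1,\dots,q\}$ with $g_{k_a}(0)<0$ for all $a$, and $(i)=(i_1,\dots,i_{r-\ell})$ a set of indices in $\{1,\dots,r\}$ such that $d(h_{i_1})_0,\dots,d(h_{i_{r-\ell}})_0$ are linearly independent. Let $\iota_{(i)}:(\mathbb R^{n-r+\ell},0)\to(\mathbb R^n,0)$ be an immersion-germ onto the submanifold-germ $(h_{i_1},\dots,h_{i_{r-\ell}})^{-1}(0)$. The reduction $(g,h)_{\iota_{(i)},(k)}:(\mathbb R^{n-r+\ell},0)\to\mathbb R^{s}\times\mathbb R^{\ell}$ is the constraint map-germ whose inequality components are $g_j\circ\iota_{(i)}$ for $j\notin(k)$ and whose equality components are $h_j\circ\iota_{(i)}$ for $j\notin(i)$. *)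

(* Defs.v *)
From HB Require Import structures.
From mathcomp Require Import all_boot all_order all_algebra all_fingroup.
From mathcomp Require Import all_classical all_reals all_analysis.

Set Implicit Arguments.
Unset Strict Implicit.
Unset Printing Implicit Defensive.

Import Order.TTheory GRing.Theory Num.Theory.
Import numFieldNormedType.Exports.

Local Open Scope classical_set_scope.
Local Open Scope ring_scope.

(** A point of R^n is a row vector.  The values of g and h are column vectors,
    so that the matrices A, B, C act by left multiplication.  A germ at 0 is
    given by a total function representing it; every condition below depends
    only on the germ of this function at 0. *)

Section Germs.
Context {R : realType}.

(** The iterated partial derivative along the coordinates listed in [s]. *)
Definition partial n (W : normedModType R) (s : seq 'I_n)
    (f : 'rV[R]_n -> W) : 'rV[R]_n -> W :=
  foldr (fun i u => 'D_(delta_mx 0 i) u) f s.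

(** The neighborhood of 0 is chosen before the order of differentiation:
    this is C^infinity near 0. *)
Definition smooth_germ n (W : normedModType R) (f : 'rV[R]_n -> W) : Prop :=
  \forall x \near (0 : 'rV[R]_n), forall s : seq 'I_n,
    {for x, continuous (partial s f)} /\
    forall i : 'I_n, derivable (partial s f) x (delta_mx 0 i).

Definition same_jet m n (W : normedModType R) (f f' : 'rV[R]_n -> W) : Prop :=
  forall s : seq 'I_n, (size s <= m)%N -> partial s f 0 = partial s f' 0.

Definition diffeo_germ n (Phi Psi : 'rV[R]_n -> 'rV[R]_n) : Prop :=
  [/\ smooth_germ Phi /\ Phi 0 = 0,
      smooth_germ Psi /\ Psi 0 = 0,
      \forall x \near (0 : 'rV[R]_n), Psi (Phi x) = x &
      \forall y \near (0 : 'rV[R]_n), Phi (Psi y) = y].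

Definition constraint_germ n q r
    (g : 'rV[R]_n -> 'cV[R]_q) (h : 'rV[R]_n -> 'cV[R]_r) : Prop :=
  [/\ smooth_germ g, smooth_germ h & h 0 = 0].

Definition feasible_set n q r
    (g : 'rV[R]_n -> 'cV[R]_q) (h : 'rV[R]_n -> 'cV[R]_r) : set 'rV[R]_n :=
  [set x | (forall i, g x i 0 <= 0) /\ (forall j, h x j 0 = 0)].

(** The germ of [Z] at 0 differs from the germ of the empty set. *)
Definition nonempty_set_germ n (Z : set 'rV[R]_n) : Prop :=
  forall U : set 'rV[R]_n, nbhs (0 : 'rV[R]_n) U -> Z `&` U !=set0.

Definition pos_diag_perm q (M : 'M[R]_q) : Prop :=
  exists (d : 'rV[R]_q) (sigma : 'S_q),
    (forall i, 0 < d 0 i) /\ M = diag_mx d *m perm_mx sigma.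

Definition KG_equivalent n q r
    (g : 'rV[R]_n -> 'cV[R]_q) (h : 'rV[R]_n -> 'cV[R]_r)
    (g' : 'rV[R]_n -> 'cV[R]_q) (h' : 'rV[R]_n -> 'cV[R]_r) : Prop :=
  exists (Phi Psi : 'rV[R]_n -> 'rV[R]_n)
    (C : 'rV[R]_n -> 'M[R]_q) (B : 'rV[R]_n -> 'M[R]_(q, r))
    (A : 'rV[R]_n -> 'M[R]_r),
    [/\ diffeo_germ Phi Psi,
        [/\ smooth_germ C, smooth_germ B & smooth_germ A] &
        \forall x \near (0 : 'rV[R]_n),
          [/\ pos_diag_perm (C x), A x \in unitmx,
              g x = C x *m g' (Psi x) + B x *m h' (Psi x) &
              h x = A x *m h' (Psi x)]].

Definition KG_determined m n q r
    (g : 'rV[R]_n -> 'cV[R]_q) (h : 'rV[R]_n -> 'cV[R]_r) : Prop :=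
  forall (g' : 'rV[R]_n -> 'cV[R]_q) (h' : 'rV[R]_n -> 'cV[R]_r),
    constraint_germ g' h' -> same_jet m g' g -> same_jet m h' h ->
    KG_equivalent g' h' g h.

Definition finitely_KG_determined n q r
    (g : 'rV[R]_n -> 'cV[R]_q) (h : 'rV[R]_n -> 'cV[R]_r) : Prop :=
  exists m : nat, KG_determined m g h.

Definition lin_indep_differentials n r
    (h : 'rV[R]_n -> 'cV[R]_r) (I : {set 'I_r}) : Prop :=
  forall c : 'I_r -> R,
    (forall v : 'rV[R]_n,
        \sum_(i in I) c i * 'd (fun x => h x i 0 : R^o) (0 : 'rV[R]_n) v = 0) ->
    forall i, i \in I -> c i = 0.

(** The last two clauses say that, as set-germs at 0, the image of [iota] is
    [Z], the image being taken over arbitrarily small neighborhoods of 0. *)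
Definition immersion_germ_onto m n
    (iota : 'rV[R]_m -> 'rV[R]_n) (Z : set 'rV[R]_n) : Prop :=
  [/\ smooth_germ iota, iota 0 = 0,
      injective ('d iota (0 : 'rV[R]_m)),
      \forall x \near (0 : 'rV[R]_m), Z (iota x) &
      forall U : set 'rV[R]_m, nbhs (0 : 'rV[R]_m) U ->
        \forall y \near (0 : 'rV[R]_n), Z y -> (iota @` U) y].

Definition increasing_enum s q (J : {set 'I_q}) (a : 'I_s -> 'I_q) : Prop :=
  (forall i j : 'I_s, (i < j)%N -> (a i < a j)%N) /\
  (forall j : 'I_q, j \in J <-> exists i, a i = j).

(** [(gr, hr)] is the reduction of [(g, h)] along [iota], [I] and [K].
    As #|I| = r - l, the equation on dimensions reads m = n - r + l. *)
Definition is_reduction n q r m s l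
    (g : 'rV[R]_n -> 'cV[R]_q) (h : 'rV[R]_n -> 'cV[R]_r)
    (iota : 'rV[R]_m -> 'rV[R]_n) (I : {set 'I_r}) (K : {set 'I_q})
    (gr : 'rV[R]_m -> 'cV[R]_s) (hr : 'rV[R]_m -> 'cV[R]_l) : Prop :=
  [/\ forall j, j \in K -> g 0 j 0 < 0,
      lin_indep_differentials h I,
      (m + r = n + l)%N,
      immersion_germ_onto iota [set x | forall i, i \in I -> h x i 0 = 0] &
      exists (a : 'I_s -> 'I_q) (b : 'I_l -> 'I_r),
        [/\ increasing_enum (~: K)%SET a, increasing_enum (~: I)%SET b,
            gr = (fun x => rowsub a (g (iota x))) &
            hr = (fun x => rowsub b (h (iota x)))]].

End Germs.

(* Main.v *)
Require Import Defs.
From HB Require Import structures.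
From mathcomp Require Import all_boot all_order all_algebra all_fingroup.
From mathcomp Require Import all_classical all_reals all_analysis.
From mathcomp Require Import ring lra.

(** Write [u = Psi o iota], where [Psi] is the diffeomorphism of the given
    equivalence, and let [P] be a linear projection whose restrictions to the
    tangent spaces of the images of [u] and [iota'] are both bijective.  Then
    [psi = (iota' P)^-1 o (u P)] is a diffeomorphism-germ, and [u] and
    [v = iota' o psi] have the same image under [P].  By Hadamard's lemma the
    difference [v - u] has its components in the ideal generated by the reduced
    equalities [hr], and also in the one generated by [w = hr' o psi].  Hence
    [w = M1 hr] and [hr = M2 w], and as in Mather's argument
    [hr = (M2 + S (1 - M1 M2)) w] for every constant matrix [S], which can be
    chosen so that the coefficient is invertible at 0.  Modulo this ideal the
    inequalities are unchanged by replacing [u] with [v]; those that are active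
    at 0 are matched by the given equivalence, and the remaining negative ones
    can be matched arbitrarily, their quotients being positive and smooth. *)

(** The index sets of the two reductions are unrelated, so [Psi] need not carry one submanifold to
    the other, even to first order: only their dimensions agree. Hence a projection is sought that
    is injective on two different tangent spaces at once, which is possible because a line of
    candidate matrices has finitely many bad parameters. That [v - u] lies in both ideals is seen in
    charts: the defining equations of one submanifold together with [P] form local coordinates, and
    only the equations can differ between [u] and [v]. They vanish along one of the two maps and, by
    the given equivalence, are combinations of the remaining equalities along the other. The reduced
    equalities need not be a minimal system of generators of their ideal, so [w = M1 M2 w] does not
    force [M1] or [M2] to be invertible; this is the obstacle that [S] removes. All coefficients
    have to be smooth germs, so division by [v - u] goes through integrals depending on a
    parameter. *)

Set Implicit Arguments.
Unset Strict Implicit.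
Unset Printing Implicit Defensive.

Import Order.TTheory GRing.Theory Num.Theory.
Import numFieldNormedType.Exports.

Local Open Scope classical_set_scope.
Local Open Scope ring_scope.

(** * Functions of class C^k on an open set *)

(* These are stated over an abstract space because [nbhs] unfolds on matrices,
   which defeats the inference of [Filter]. *)
Lemma near_forall (T : topologicalType) (I : finType) (x : T) (P : I -> T -> Prop) :
  (forall i, \forall y \near x, P i y) -> \forall y \near x, forall i, P i y.
Proof. exact: filter_forall. Qed.

Lemma near_and (T : topologicalType) (x : T) (P Q : T -> Prop) :
  (\forall y \near x, P y) -> (\forall y \near x, Q y) ->
  \forall y \near x, P y /\ Q y.
Proof. exact: filterI. Qed.

Lemma near_imp (T : topologicalType) (x : T) (P Q : T -> Prop) :
  (forall y, P y -> Q y) -> (\forall y \near x, P y) -> \forall y \near x, Q y.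
Proof. exact: filterS. Qed.

Lemma near_imp2 (T : topologicalType) (x : T) (P Q S : T -> Prop) :
  (forall y, P y -> Q y -> S y) -> (\forall y \near x, P y) ->
  (\forall y \near x, Q y) -> \forall y \near x, S y.
Proof. exact: filterS2. Qed.

Lemma near_imp3 (T : topologicalType) (x : T) (P Q S V : T -> Prop) :
  (forall y, P y -> Q y -> S y -> V y) -> (\forall y \near x, P y) ->
  (\forall y \near x, Q y) -> (\forall y \near x, S y) ->
  \forall y \near x, V y.
Proof. exact: filterS3. Qed.

Lemma near_eq_continuous (S T : topologicalType) (f g : S -> T) x :
  (\forall y \near x, f y = g y) -> {for x, continuous f} ->
  {for x, continuous g}.
Proof.
move=> fg; rewrite /prop_for /continuous_at -(nbhs_singleton fg) => cf.
by apply: cvg_trans cf; apply: near_eq_cvg; apply: filterS fg => y ->.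
Qed.

Section class_Ck.
Context {R : realType}.

(** Scalar-valued and recursive in the partial derivatives, so that each closure property is an
    induction on [k] through the matching derivative rule; matrices are treated entrywise.
    Continuity is part of every level because the existence of partial derivatives does not imply
    it. *)
Fixpoint Ck k n (U : set 'rV[R]_n) (f : 'rV[R]_n -> R) : Prop :=
  (forall x, U x -> {for x, continuous f}) /\
  if k is k'.+1 then
    (forall x i, U x -> derivable f x (delta_mx 0 i)) /\
    (forall i, Ck k' U ('D_(delta_mx 0 i) f))
  else True.

Section closure.
Variables (n : nat) (U : set 'rV[R]_n).
Implicit Types (f g : 'rV[R]_n -> R) (k : nat).

Lemma Ck_cont k f x : Ck k U f -> U x -> {for x, continuous f}.
Proof. by case: k => [|k] [cf _]; exact: cf. Qed.

Arguments Ck_cont {k f x} _ _ : rename.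

Lemma Ck_der k f x i : Ck k.+1 U f -> U x -> derivable f x (delta_mx 0 i).
Proof. by move=> [_ [df _]]; exact: df. Qed.

Arguments Ck_der {k f x} i _ _ : rename.

Lemma Ck_D k f i : Ck k.+1 U f -> Ck k U ('D_(delta_mx 0 i) f).
Proof. by move=> [_ [_ df]]; exact: df. Qed.

Lemma CkS k f : (forall x, U x -> {for x, continuous f}) ->
  (forall x i, U x -> derivable f x (delta_mx 0 i)) ->
  (forall i, Ck k U ('D_(delta_mx 0 i) f)) -> Ck k.+1 U f.
Proof. by []. Qed.

Lemma CkW k f : Ck k.+1 U f -> Ck k U f.
Proof.
elim: k f => [|k IH] f Cf; first by split=> // x Ux; exact: (Ck_cont Cf Ux).
apply: CkS => [x Ux|x i Ux|i]; [exact: (Ck_cont Cf Ux)|exact: (Ck_der _ Cf Ux)|].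
exact/IH/(Ck_D _ Cf).
Qed.

Lemma Ck1 k f : Ck k.+1 U f -> Ck 1 U f.
Proof. by elim: k => // k IH /CkW. Qed.

Lemma Ck_sub (V : set 'rV[R]_n) k f : U `<=` V -> Ck k V f -> Ck k U f.
Proof.
move=> UV; elim: k f => [|k IH] f.
  by move=> [cf _]; split=> // x /UV; exact: cf.
move=> [cf [df Df]]; split; first by move=> x /UV; exact: cf.
by split=> [x i /UV|i]; [exact: df|exact/IH/Df].
Qed.

Hypothesis oU : open U.

Lemma open_near_eq f g x : (forall y, U y -> f y = g y) -> U x ->
  \forall y \near x, f y = g y.
Proof.
move=> fg Ux; have : nbhs x U by apply: open_nbhs_nbhs.
by apply: filterS => y /fg.
Qed.

(** The derivative rules give formulas valid only at points of [U]. As [U] is open and derivatives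
    are local, such a formula may replace the derivative in the inductions below. *)
Lemma Ck_eq k f g : (forall x, U x -> f x = g x) -> Ck k U f -> Ck k U g.
Proof.
elim: k f g => [|k IH] f g fg.
  move=> [cf _]; split=> // x Ux.
  exact: near_eq_continuous (open_near_eq fg Ux) (cf x Ux).
move=> Cf; apply: CkS => [x Ux|x i Ux|i].
- exact: near_eq_continuous (open_near_eq fg Ux) (Ck_cont Cf Ux).
- exact: near_eq_derivable (open_near_eq fg Ux) (Ck_der _ Cf Ux).
- apply: (IH _ _ _ (Ck_D i Cf)) => x Ux.
  exact: near_eq_derive (open_near_eq fg Ux).
Qed.

Lemma Ck_cst k (c : R) : Ck k U (fun=> c).
Proof.
elim: k c => [|k IH] c; first by split=> // x _; exact: cst_continuous.
apply: CkS => [x _|x i _|i]; [exact: cst_continuous|exact: (derivable_cst c)|].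
by apply: (Ck_eq _ (IH 0)) => x _; rewrite derive_cst.
Qed.

Lemma Ck_add k f g : Ck k U f -> Ck k U g -> Ck k U (fun x => f x + g x).
Proof.
elim: k f g => [|k IH] f g Cf Cg.
  by split=> // x Ux; apply: continuousD; [exact: (Ck_cont Cf Ux)|exact: (Ck_cont Cg Ux)].
apply: CkS => [x Ux|x i Ux|i].
- by apply: continuousD; [exact: (Ck_cont Cf Ux)|exact: (Ck_cont Cg Ux)].
- by apply: derivableD; [exact: (Ck_der _ Cf Ux)|exact: (Ck_der _ Cg Ux)].
- apply: (Ck_eq _ (IH _ _ (Ck_D i Cf) (Ck_D i Cg))) => x Ux.
  by rewrite (deriveD (Ck_der _ Cf Ux) (Ck_der _ Cg Ux)).
Qed.

Lemma Ck_opp k f : Ck k U f -> Ck k U (fun x => - f x).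
Proof.
elim: k f => [|k IH] f Cf.
  by split=> // x Ux; apply: continuousN; exact: (Ck_cont Cf Ux).
apply: CkS => [x Ux|x i Ux|i].
- by apply: continuousN; exact: (Ck_cont Cf Ux).
- by apply: derivableN; exact: (Ck_der _ Cf Ux).
- apply: (Ck_eq _ (IH _ (Ck_D i Cf))) => x Ux.
  by rewrite (deriveN (Ck_der _ Cf Ux)).
Qed.

Lemma Ck_mul k f g : Ck k U f -> Ck k U g -> Ck k U (fun x => f x * g x).
Proof.
elim: k f g => [|k IH] f g Cf Cg.
  by split=> // x Ux; apply: continuousM; [exact: (Ck_cont Cf Ux)|exact: (Ck_cont Cg Ux)].
apply: CkS => [x Ux|x i Ux|i].
- by apply: continuousM; [exact: (Ck_cont Cf Ux)|exact: (Ck_cont Cg Ux)].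
- by apply: derivableM; [exact: (Ck_der _ Cf Ux)|exact: (Ck_der _ Cg Ux)].
- have := Ck_add (IH _ _ (CkW Cf) (Ck_D i Cg)) (IH _ _ (CkW Cg) (Ck_D i Cf)).
  apply: Ck_eq => x Ux.
  by rewrite (deriveM (Ck_der _ Cf Ux) (Ck_der _ Cg Ux)).
Qed.

Lemma Ck_inv k f : (forall x, U x -> f x != 0) -> Ck k U f ->
  Ck k U (fun x => (f x)^-1).
Proof.
move=> f0; elim: k => [|k IH] Cf.
  by split=> // x Ux; apply: continuousV; [exact: f0|exact: (Ck_cont Cf Ux)].
apply: CkS => [x Ux|x i Ux|i].
- by apply: continuousV; [exact: f0|exact: (Ck_cont Cf Ux)].
- by apply: derivableV; [exact: f0|exact: (Ck_der _ Cf Ux)].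
- have Cf' := IH (CkW Cf).
  have := Ck_mul (Ck_opp (Ck_mul Cf' Cf')) (Ck_D i Cf).
  apply: Ck_eq => x Ux.
  rewrite (deriveV (f0 _ Ux) (Ck_der _ Cf Ux)).
  by rewrite -invfM -expr2.
Qed.

Lemma Ck_sum k (I : Type) (r : seq I) (P : pred I) (F : I -> 'rV[R]_n -> R) :
  (forall i, P i -> Ck k U (F i)) -> Ck k U (fun x => \sum_(i <- r | P i) F i x).
Proof.
move=> CF; elim: r => [|a r IH].
  by apply: (Ck_eq _ (Ck_cst k 0)) => x _; rewrite big_nil.
have [Pa|Pa] := boolP (P a); last first.
  by apply: (Ck_eq _ IH) => x _; rewrite big_cons (negbTE Pa).
by apply: (Ck_eq _ (Ck_add (CF a Pa) IH)) => x _; rewrite big_cons Pa.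
Qed.

Lemma Ck_prod k (I : Type) (r : seq I) (P : pred I) (F : I -> 'rV[R]_n -> R) :
  (forall i, P i -> Ck k U (F i)) -> Ck k U (fun x => \prod_(i <- r | P i) F i x).
Proof.
move=> CF; elim: r => [|a r IH].
  by apply: (Ck_eq _ (Ck_cst k 1)) => x _; rewrite big_nil.
have [Pa|Pa] := boolP (P a); last first.
  by apply: (Ck_eq _ IH) => x _; rewrite big_cons (negbTE Pa).
by apply: (Ck_eq _ (Ck_mul (CF a Pa) IH)) => x _; rewrite big_cons Pa.
Qed.

Lemma derive_coord (j : 'I_n) x v : is_derive x v (fun x : 'rV[R]_n => x 0 j) (v 0 j).
Proof.
have H : (fun h : R => h^-1 *: (((fun x : 'rV[R]_n => x 0 j) \o shift x) (h *: v) - x 0 j))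
   @ 0^' --> v 0 j.
  apply: (@cvg_trans _ ((fun=> v 0 j) @ (0 : R)^')); last exact: cvg_cst.
  apply: near_eq_cvg; near=> h.
  rewrite /= !mxE addrK scalerA mulVf ?scale1r//.
  by near: h; exact: nbhs_dnbhs_neq.
split; first by apply/cvg_ex; exists (v 0 j).
exact: cvg_lim H.
Unshelve. all: by end_near. Qed.

Lemma Ck_coord k (j : 'I_n) : Ck k U (fun x => x 0 j).
Proof.
case: k => [|k]; first by split=> // x _; exact: coord_continuous.
apply: CkS => [x _|x i _|i]; first exact: coord_continuous.
  by have [] := derive_coord j x (delta_mx 0 i).
apply: (Ck_eq _ (Ck_cst k ((delta_mx 0 i : 'rV[R]_n) 0 j))) => x Ux.
by have [_ ->] := derive_coord j x (delta_mx 0 i).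
Qed.

End closure.
Arguments Ck_cont {n U k f x} _ _ : rename.
Arguments Ck_der {n U k f x} i _ _ : rename.
End class_Ck.
Arguments Ck_cont {R n U k f x} _ _ : rename.
Arguments Ck_der {R n U k f x} i _ _ : rename.

(** * Mean value estimates along coordinate directions *)

Section mean_value.
Context {R : realType}.

Lemma is_derive_line (V : normedModType R) (f : V -> R) (z v : V) (s : R) :
  derivable f (z + s *: v) v ->
  is_derive s 1 (fun t : R => f (z + t *: v)) ('D_v f (z + s *: v)).
Proof.
move=> df.
have E : (fun h : R => h^-1 *: (((fun t : R => f (z + t *: v)) \o shift s) (h *: 1)
             - f (z + s *: v))) =
  (fun h : R => h^-1 *: ((f \o shift (z + s *: v)) (h *: v) - f (z + s *: v))).
  apply/funext => h /=; congr (_ *: (f _ - _)).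
  by rewrite scalerDl -[h *: 1]/(h * 1) mulr1 addrCA.
by split; rewrite /derivable /derive E.
Qed.

Lemma mvt_line (V : normedModType R) (f : V -> R) (z v : V) (a b : R) :
  a <= b -> (forall s, a <= s <= b -> derivable f (z + s *: v) v) ->
  exists2 c, a <= c <= b &
    f (z + b *: v) - f (z + a *: v) = 'D_v f (z + c *: v) * (b - a).
Proof.
move=> ab df.
have [||c cab E] := @MVT_segment R (fun t => f (z + t *: v))
  (fun s => 'D_v f (z + s *: v)) a b ab; last first.
- by exists c => //; move: cab; rewrite in_itv.
- apply: derivable_within_continuous => x; rewrite in_itv/= => xab.
  by have [] := is_derive_line (df x xab).
- move=> x; rewrite in_itv/= => /andP[ax xb]; apply: is_derive_line.
  by apply: df; rewrite !ltW.
Qed.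

(** The segment is parametrized by [t] in [0,1], so that callers need not know the sign of [h]; the
    two signs are separated inside the proof. *)
Lemma mvt_bound n (f : 'rV[R]_n -> R) (z : 'rV[R]_n) k (h c e : R) :
  (forall t, 0 <= t <= 1 ->
     derivable f (z + (t * h) *: delta_mx 0 k) (delta_mx 0 k) /\
     `|'D_(delta_mx 0 k) f (z + (t * h) *: delta_mx 0 k) - c| <= e) ->
  `|f (z + h *: delta_mx 0 k) - f z - c * h| <= e * `|h|.
Proof.
move=> H.
have [->|hn0] := eqVneq h 0.
  by rewrite scale0r addr0 mulr0 subrr subr0 normr0 mulr0.
have K s : (0 <= s <= h) || (h <= s <= 0) ->
     derivable f (z + s *: delta_mx 0 k) (delta_mx 0 k) /\
     `|'D_(delta_mx 0 k) f (z + s *: delta_mx 0 k) - c| <= e.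
  move=> sh; rewrite -[s](divfK hn0); apply: H.
  move: sh => /orP[|] /andP[s0 sh].
    have hp : 0 < h by rewrite lt_neqAle eq_sym hn0/= (le_trans s0).
    by rewrite divr_ge0 ?(ltW hp)//= ler_pdivrMr// mul1r.
  have hp : h < 0 by rewrite lt_neqAle hn0/= (le_trans s0).
  by rewrite mulr_le0 ?invr_le0 ?(ltW hp)//= ler_ndivrMr// mul1r.
have [h0|h0] := leP 0 h.
  have [|s sh] := @mvt_line _ f z (delta_mx 0 k) 0 h h0.
    by move=> s sh; apply: (K s _).1; rewrite sh.
  rewrite scale0r addr0 subr0 => ->.
  by rewrite -mulrBl normrM ler_wpM2r//; apply: (K s _).2; rewrite sh.
have [|s sh] := @mvt_line _ f z (delta_mx 0 k) h 0 (ltW h0).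
  by move=> s sh; apply: (K s _).1; rewrite sh orbT.
rewrite scale0r addr0 sub0r => E.
have -> : f (z + h *: delta_mx 0 k) - f z - c * h =
    ('D_(delta_mx 0 k) f (z + s *: delta_mx 0 k) - c) * h.
  by rewrite mulrBl -(opprB (f z)) E mulrN opprK.
by rewrite normrM ler_wpM2r//; apply: (K s _).2; rewrite sh orbT.
Qed.

Lemma convex_norm_lt (p q t d : R) : `|p| < d -> `|q| < d -> 0 <= t <= 1 ->
  `|(1 - t) * p + t * q| < d.
Proof.
move=> pd qd /andP[t0 t1]; apply: le_lt_trans (ler_normD _ _) _.
rewrite !normrM (ger0_norm t0) ger0_norm ?subr_ge0//.
pose M := Num.max `|p| `|q|.
have Md : M < d by rewrite gt_max pd qd.
apply: le_lt_trans Md; have -> : M = (1 - t) * M + t * M by ring.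
by rewrite lerD// ler_wpM2l ?subr_ge0// /M le_max lexx ?orbT.
Qed.

Lemma rV_ballP n (x y : 'rV[R]_n) e : 0 < e ->
  ball x e y <-> forall j, `|x 0 j - y 0 j| < e.
Proof.
move=> e0; split=> [[_ H] j|H]; first exact: H.
by split=> // i j; rewrite (ord1 i); exact: H.
Qed.

Lemma rV_normP n (x : 'rV[R]_n) e : 0 <= e ->
  `|x| <= e <-> forall j, `|x 0 j| <= e.
Proof.
move=> e0; rewrite [`|x|]mx_normrE; split=> [H j|H].
  by apply: le_trans H; exact: (le_bigmax _ (fun ij => `|x ij.1 ij.2|) (0, j)).
by apply: bigmax_le => // -[i j] _; rewrite (ord1 i); exact: H.
Qed.

(** The points [a + rtake k v] are the corners of the staircase path from [a] to [a + v] that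
    changes one coordinate at a time. *)
Definition rtake n (k : nat) (v : 'rV[R]_n) : 'rV[R]_n :=
  \row_j (if (j < k)%N then v 0 j else 0).

(** Telescoping along the staircase path reduces the estimate to one variable. The path stays in the
    ball because balls are taken for the sup norm and each coordinate stays between those of [a] and
    [a + v]. The reference slopes [c] are not tied to the base point [a]: the inverse function
    theorem takes them at 0 while [a] varies. *)
Lemma mvt_ball n (f : 'rV[R]_n -> R) (x a v : 'rV[R]_n) (c : 'I_n -> R) (d e : R) :
  0 < d ->
  (forall z k, ball x d z -> derivable f z (delta_mx 0 k) /\
     `|'D_(delta_mx 0 k) f z - c k| <= e) ->
  ball x d a -> ball x d (a + v) ->
  `|f (a + v) - f a - \sum_k c k * v 0 k| <= e * \sum_k `|v 0 k|.
Proof.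
move=> d0 H /(rV_ballP _ _ d0) xa /(rV_ballP _ _ d0) xav.
suff K : forall m, (m <= n)%N ->
    `|f (a + rtake m v) - f a - \sum_(k < n | (k < m)%N) c k * v 0 k| <=
       e * \sum_(k < n | (k < m)%N) `|v 0 k|.
  have := K n (leqnn n).
  have -> : rtake n v = v by apply/rowP => j; rewrite mxE ltn_ord.
  by under eq_bigl do rewrite ltn_ord; under [X in _ * X]eq_bigl do rewrite ltn_ord.
elim=> [_|m IH mn].
  have -> : rtake 0 v = 0 by apply/rowP => j; rewrite !mxE.
  by rewrite addr0 !big_pred0 ?subrr ?subr0 ?normr0 ?mulr0.
have {IH} := IH (ltnW mn).
pose k := Ordinal mn.
have S (G : 'I_n -> R) : \sum_(j < n | (j < m.+1)%N) G j =
    G k + \sum_(j < n | (j < m)%N) G j.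
  rewrite (bigD1 k)//=; congr (_ + _); apply: eq_bigl => j.
  by rewrite ltnS ltn_neqAle andbC -(inj_eq val_inj).
have -> : rtake m.+1 v = rtake m v + v 0 k *: delta_mx 0 k.
  apply/rowP => j; rewrite !mxE eqxx/= ltnS leq_eqVlt -(inj_eq val_inj)/=.
  by have [E|] := eqVneq (j : nat) m;
   rewrite ?E ?ltnn/= ?mulr0 ?addr0 ?add0r ?mulr1//; congr (v _ _); exact: val_inj.
rewrite !S addrA => IH.
have B : `|f (a + rtake m v + v 0 k *: delta_mx 0 k) - f (a + rtake m v) -
    c k * v 0 k| <= e * `|v 0 k|.
  apply: mvt_bound => t /andP[t0 t1]; apply: H; apply/rV_ballP => // j.
  rewrite !mxE eqxx/=; have := xa j; have := xav j; rewrite !mxE => avj aj.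
  have [->|jk] := eqVneq j k; last first.
    rewrite mulr0 addr0; case: ifP => _; first by [].
    by rewrite addr0.
  rewrite /= ltnn addr0 mulr1.
  have := @convex_norm_lt (x 0 k - a 0 k) (x 0 k - (a 0 k + v 0 k)) t d.
  have -> : (1 - t) * (x 0 k - a 0 k) + t * (x 0 k - (a 0 k + v 0 k)) =
    x 0 k - (a 0 k + t * v 0 k) by ring.
  by apply; rewrite ?t0 ?t1//; have := xav k; rewrite !mxE.
rewrite mulrDr; apply: le_trans (lerD B IH).
apply: le_trans (ler_normD _ _); rewrite le_eqVlt; apply/orP; left; apply/eqP.
by congr (`|_|); ring.
Qed.

End mean_value.

(** * Differentiability of C^1 functions and the chain rule *)

Section differentiability.
Context {R : realType}.

Lemma mx_continuous (T : topologicalType) m n (M : T -> 'M[R]_(m, n)) x :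
  (forall i j, {for x, continuous (fun y => M y i j)}) -> {for x, continuous M}.
Proof.
move=> cM; apply/cvg_ballP => e e0.
have : \forall y \near x, forall i j, ball (M x i j) e (M y i j).
  apply: filter_forall => i; apply: filter_forall => j.
  by move/cvg_ballP : (cM i j) => /(_ e e0).
by apply: filterS => y H; split.
Qed.

Section lform.
Variables (n : nat) (c : 'I_n -> R).
Definition lform (v : 'rV[R]_n) : R := \sum_k c k * v 0 k.

Lemma lform_linear : linear_for ( *:%R : R -> R^o -> R^o) lform.
Proof.
move=> a u v; change (lform (a *: u + v) = a * lform u + lform v).
rewrite /lform mulr_sumr -big_split/=.
by apply: eq_bigr => k _; rewrite !mxE; ring.
Qed.

HB.instance Definition _ :=
  @GRing.isLinear.Build R 'rV[R]_n R^o _ lform lform_linear.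

Lemma lform_continuous : continuous lform.
Proof.
have C : Ck 0 setT lform.
  apply: Ck_sum => [|i _]; first exact: openT.
  apply: (Ck_mul openT); [exact: (Ck_cst openT)|exact: (Ck_coord openT)].
move=> x; exact: (Ck_cont C).
Qed.
End lform.

(** On a small ball the partial derivatives stay within [e / n.+1] of their values at [x], and
    [mvt_ball] turns this into the little-o estimate. The sum of the [n] coordinates costs a factor
    [n]; [n.+1] keeps the quotient meaningful in dimension 0. *)
Lemma C1_diff n (U : set 'rV[R]_n) (f : 'rV[R]_n -> R) x : open U ->
  Ck 1 U f -> U x ->
  differentiable f x /\
  'd f x = lform (fun k => 'D_(delta_mx 0 k) f x) :> ('rV[R]_n -> R).
Proof.
move=> oU Cf Ux; set c := fun k => _.
have H : f \o shift x = cst (f x) + lform c +o_ (0 : 'rV[R]_n) id.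
  apply/eqaddoP => _/posnumP[e].
  have e0 : 0 < e%:num / n.+1%:R by rewrite divr_gt0.
  have : \forall z \near x, forall k : 'I_n, U z /\
      `|'D_(delta_mx 0 k) f x - 'D_(delta_mx 0 k) f z| <= e%:num / n.+1%:R.
    apply: near_forall => k; apply: near_and; first exact: open_nbhs_nbhs.
    have := Ck_cont (Ck_D k Cf) Ux.
    by move=> /cvgrPdist_le /(_ _ e0).
  move=> /nbhs_ballP[d /= d0 xd].
  have : \forall h \near (0 : 'rV[R]_n), `|h| < d by exact: nbhs0_lt.
  apply: filterS => h hlt.
  have hd : ball x d (x + h).
    apply/rV_ballP => // j; rewrite !mxE opprD addrA subrr sub0r normrN.
    by apply: le_lt_trans hlt; move: j; apply/rV_normP.
  have := @mvt_ball R n f x x h c d (e%:num / n.+1%:R) d0 _ (ballxx _ d0) hd.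
  move=> /(_ _)/wrap[].
    move=> z k /xd/(_ k) [Uz Dz]; split; first exact: (Ck_der _ Cf Uz).
    by rewrite distrC.
  have -> : (f \o shift x - (cst (f x) + lform c)) h =
     f (x + h) - f x - \sum_k c k * h 0 k.
    by rewrite !fctE /= opprD addrA [h + x]addrC.
  move=> /le_trans; apply.
  have : \sum_k `|h 0 k| <= n%:R * `|h|.
    apply: le_trans (_ : \sum_(k < n) `|h| <= _).
      by apply: ler_sum => k _; apply/rV_normP: k.
    by rewrite sumr_const card_ord mulr_natl.
  move=> /(ler_wpM2l (ltW e0))/le_trans; apply.
  rewrite mulrA ler_wpM2r// -mulrA ler_piMr// mulrC ler_pdivrMr// mul1r.
  by rewrite ler_nat.
have dfE : 'd f x = lform c :> (_ -> _).
  exact: (@diff_unique R _ _ f (lform c) x (@lform_continuous _ c) H).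
split=> //; apply/diff_locallyP; rewrite dfE; split=> //.
exact: lform_continuous.
Qed.

Lemma row_differentiable m n (u : 'rV[R]_m -> 'rV[R]_n) x :
  (forall j, differentiable (fun x => u x 0 j) x) -> differentiable u x.
Proof.
move=> du.
have -> : u = \sum_(j < n) (fun x => u x 0 j *: (delta_mx 0 j : 'rV[R]_n)).
  apply/funext => y; rewrite fct_sumE; apply/rowP => k.
  rewrite summxE (bigD1 k)//= !mxE !eqxx mulr1 big1 ?addr0// => j jk.
  by rewrite !mxE eqxx eq_sym (negbTE jk) mulr0.
apply: differentiable_sum => j.
exact: (@differentiableZl R _ _ (fun x => u x 0 j)).
Qed.

Lemma row_diffE m n (U : set 'rV[R]_m) (u : 'rV[R]_m -> 'rV[R]_n) x v : open U ->
  (forall j, Ck 1 U (fun x => u x 0 j)) -> U x ->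
  'd u x v = v *m \matrix_(i, j) 'D_(delta_mx 0 i) (fun x => u x 0 j) x.
Proof.
move=> oU Cu Ux.
have du : differentiable u x.
  by apply: row_differentiable => j; have [] := C1_diff oU (Cu j) Ux.
rewrite -deriveE// derive_mx; last exact: diff_derivable.
apply/rowP => j; rewrite !mxE.
have [dj djE] := C1_diff oU (Cu j) Ux.
rewrite deriveE// djE /lform; apply: eq_bigr => k _.
by rewrite mxE mulrC.
Qed.

Lemma comp_diff m n (U : set 'rV[R]_m) (V : set 'rV[R]_n)
   (u : 'rV[R]_m -> 'rV[R]_n) f x i : open U -> open V ->
  (forall j, Ck 1 U (fun x => u x 0 j)) -> Ck 1 V f ->
  U x -> V (u x) ->
  is_derive x (delta_mx 0 i) (f \o u)
   (\sum_j 'D_(delta_mx 0 j) f (u x) * 'D_(delta_mx 0 i) (fun x => u x 0 j) x).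
Proof.
move=> oU oV Cu Cf Ux Vux.
have du : differentiable u x.
  by apply: row_differentiable => j; have [] := C1_diff oU (Cu j) Ux.
have [df dfE] := C1_diff oV Cf Vux.
have dfu : differentiable (f \o u) x by exact: differentiable_comp.
split; first exact: diff_derivable.
rewrite deriveE// diff_comp//= dfE (row_diffE _ oU Cu Ux) /lform.
apply: eq_bigr => j _; congr (_ * _); rewrite mxE (bigD1 i)//= !mxE !eqxx mul1r.
by rewrite big1 ?addr0// => k ki; rewrite !mxE (negbTE ki) andbF mul0r.
Qed.

Lemma Ck_comp k m n (U : set 'rV[R]_m) (V : set 'rV[R]_n)
   (u : 'rV[R]_m -> 'rV[R]_n) f : open U -> open V ->
  (forall j, Ck k U (fun x => u x 0 j)) -> Ck k V f ->
  (forall x, U x -> V (u x)) -> Ck k U (f \o u).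
Proof.
move=> oU oV; elim: k f => [|k IH] f Cu Cf UV.
  split=> // x Ux; apply: continuous_comp; last exact: (Ck_cont Cf (UV _ Ux)).
  by apply: mx_continuous => i j; rewrite (ord1 i); exact: (Ck_cont (Cu j) Ux).
have CD x i (Ux : U x) := comp_diff i oU oV (fun j => Ck1 (Cu j)) (Ck1 Cf) Ux (UV _ Ux).
apply: CkS.
- move=> x Ux; apply: continuous_comp; last exact: (Ck_cont Cf (UV _ Ux)).
  apply: mx_continuous => i j; rewrite (ord1 i); exact: (Ck_cont (Cu j) Ux).
- by move=> x i Ux; have [] := CD x i Ux.
- move=> i.
  apply: (Ck_eq oU (f := fun x => \sum_j 'D_(delta_mx 0 j) f (u x) *
      'D_(delta_mx 0 i) (fun x => u x 0 j) x)).
    by move=> x Ux; have [_ ->] := CD x i Ux.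
  apply: Ck_sum => // j _; apply: Ck_mul => //.
    by apply: (IH _ (fun j => CkW (Cu j)) (Ck_D j Cf)).
  exact: (Ck_D i (Cu j)).
Qed.
End differentiability.

(** * Integrals depending on a parameter *)

Section parametric_integral.
Context {R : realType}.

Lemma rcont_dist (T : topologicalType) (f : T -> R) x :
  (forall e, 0 < e -> \forall y \near x, `|f x - f y| <= e) ->
  {for x, continuous f}.
Proof. by move=> H; apply/cvgrPdist_le. Qed.

Local Notation I01 := (`[0%R, 1%R]%classic : set R).
Local Notation "'\int01' f" := (\int[lebesgue_measure]_(t in I01) f t)
  (at level 10).

(** Two-sided continuity, also at the endpoints: the integrands come from functions on an open set
    containing the whole segment. *)
Definition cont01 (f : R -> R) := forall t, I01 t -> {for t, continuous f}.

Lemma cont01_integrable (f : R -> R) : cont01 f ->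
  lebesgue_measure.-integrable I01 (EFin \o f).
Proof.
move=> cf; apply: continuous_compact_integrable; first exact: segment_compact.
by apply: continuous_in_subspaceT => t /set_mem; exact: cf.
Qed.

Lemma int01_cst (c : R) : \int01 (fun=> c) = c.
Proof.
rewrite Rintegral_cst//= lebesgue_measure_itv/= lte_fin ltr01 oppr0 adde0.
by rewrite /= mulr1.
Qed.

Lemma int01_dist (a b : R -> R) (e : R) : cont01 a -> cont01 b ->
  (forall t, 0 <= t <= 1 -> `|a t - b t| <= e) -> `|\int01 a - \int01 b| <= e.
Proof.
move=> ca cb abe.
have ia := cont01_integrable ca; have ib := cont01_integrable cb.
rewrite -RintegralB//.
have iab : lebesgue_measure.-integrable I01 (EFin \o (fun t => a t - b t)).
  apply: cont01_integrable => t It.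
  by apply: continuousB; [exact: ca|exact: cb].
apply: (le_trans (le_normr_Rintegral _ iab)) => //.
rewrite -[leRHS](int01_cst e); apply: le_Rintegral => //.
- apply: cont01_integrable => t It.
  apply: (@continuous_comp _ _ _ (fun t => a t - b t) (fun x : R => `|x|)).
    by apply: continuousB; [exact: ca|exact: cb].
  exact: (@norm_continuous R R).
- by apply: cont01_integrable => t It; exact: cst_continuous.
Qed.

Lemma int01_linear (a b : R -> R) (h : R) : cont01 a -> cont01 b ->
  \int01 (fun t => a t + h * b t) = \int01 a + h * \int01 b.
Proof.
move=> ca cb; rewrite RintegralD//; last first.
- apply: cont01_integrable => t It; apply: continuousM; last exact: cb.
  exact: cst_continuous.
- exact: cont01_integrable.
- by rewrite RintegralZl//; exact: cont01_integrable.
Qed.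

Section integrand.
Variables (m : nat) (U : set 'rV[R]_m) (W : set 'rV[R]_(m + 1)).
Hypothesis oU : open U.
Hypothesis oW : open W.

(* R^m x R is realized as row vectors, so that the C^k calculus above applies to
   the integrand. *)
Definition pt (x : 'rV[R]_m) (t : R) : 'rV[R]_(m + 1) := row_mx x t%:M.
Hypothesis UW : forall x t, U x -> 0 <= t <= 1 -> W (pt x t).

Lemma pt_continuous : continuous (fun p : R * 'rV[R]_m => pt p.2 p.1).
Proof.
move=> p; apply: mx_continuous => i j; rewrite (ord1 i).
case: (split_ordP j) => k ->.
  rewrite (_ : (fun _ => _) = (fun y : 'rV[R]_m => y 0 k) \o snd); last first.
    by apply/funext => q; rewrite /pt row_mxEl.
  apply: continuous_comp; first exact: cvg_snd.
  exact: coord_continuous.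
rewrite (_ : (fun _ => _) = fst); last first.
  by apply/funext => q; rewrite /pt row_mxEr !mxE (ord1 k) eqxx mulr1n.
exact: cvg_fst.
Qed.

Lemma pt_slice_continuous (F : 'rV[R]_(m + 1) -> R) x :
  (forall z, W z -> {for z, continuous F}) -> U x -> cont01 (fun t => F (pt x t)).
Proof.
move=> cF Ux t; rewrite /= in_itv/= => t01.
apply: (@continuous_comp _ _ _ (fun t => pt x t) F); last exact/cF/UW.
apply: mx_continuous => i j; rewrite (ord1 i); case: (split_ordP j) => k ->.
  rewrite (_ : (fun _ => _) = fun=> x 0 k); last first.
    by apply/funext => q; rewrite /pt row_mxEl.
  exact: cst_continuous.
rewrite (_ : (fun _ => _) = id); first exact: cvg_id.
by apply/funext => q; rewrite /pt row_mxEr !mxE (ord1 k) eqxx mulr1n.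
Qed.

(** Compactness of [0,1]: near each [(t, x)] both values are within [e / 2] of [F (pt x t)], and
    finitely many such neighborhoods cover the segment over [x]. *)
Lemma tube (F : 'rV[R]_(m + 1) -> R) x (e : R) : 0 < e ->
  (forall z, W z -> {for z, continuous F}) -> U x ->
  \forall y \near x, forall t, 0 <= t <= 1 -> `|F (pt x t) - F (pt y t)| <= e.
Proof.
move=> e0 cF Ux.
have cov : near_covering I01 by apply/compact_near_coveringP; exact: segment_compact.
have := cov _ (nbhs x) (fun y t => `|F (pt x t) - F (pt y t)| <= e) (nbhs_filter x).
move=> /(_ _)/wrap[].
  move=> t; rewrite /= in_itv/= => t01.
  have : {for (t, x), continuous (F \o (fun p : R * 'rV[R]_m => pt p.2 p.1))}.
    by apply: continuous_comp; [exact: pt_continuous|exact/cF/UW].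
  have e2 : 0 < e / 2 by rewrite divr_gt0.
  move=> /cvgrPdist_le /(_ _ e2) H2.
  have H1 : \forall s \near t, `|F (pt x t) - F (pt x s)| <= e / 2.
    have := pt_slice_continuous cF Ux; rewrite /cont01 => /(_ t).
    by rewrite /= in_itv/= => /(_ t01) /cvgrPdist_le /(_ _ e2).
  have H1' : \forall p \near (t, x), `|F (pt x t) - F (pt x p.1)| <= e / 2.
    by exact: (cvg_fst H1).
  apply: filterS2 H1' H2 => -[s y] /= A1 A2.
  rewrite -(subrKA (F (pt x t))) (le_trans (ler_normD _ _))//.
  by rewrite (splitr e) lerD// distrC.
by apply: filterS => y H t t01; apply: H; rewrite /= in_itv.
Qed.

Definition pint (F : 'rV[R]_(m + 1) -> R) (x : 'rV[R]_m) : R :=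
  \int01 (fun t => F (pt x t)).

Lemma pint_continuous F x : (forall z, W z -> {for z, continuous F}) -> U x ->
  {for x, continuous (pint F)}.
Proof.
move=> cF Ux; apply: rcont_dist => e e0.
have nU : \forall y \near x, U y by exact: open_nbhs_nbhs.
apply: near_imp2 nU (tube e0 cF Ux) => y Uy H.
by apply: int01_dist => //; exact: pt_slice_continuous.
Qed.

Lemma pt_shift x t i (s : R) :
  pt (x + s *: delta_mx 0 i) t = pt x t + s *: delta_mx 0 (lshift 1 i).
Proof.
apply/rowP => j; case: (split_ordP j) => k ->.
  by rewrite [LHS]row_mxEl [RHS]mxE row_mxEl !mxE eqxx/= (inj_eq (@lshift_inj _ _)).
by rewrite [LHS]row_mxEr [RHS]mxE row_mxEr !mxE eqxx/= eq_rlshift mulr0 addr0.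
Qed.

(** For fixed [t] the mean value bound compares the increment of [F] with [h] times its derivative;
    [tube], applied to the derivative, makes the bound uniform in [t], so that it survives
    integration. *)
Lemma pint_derive F x i : Ck 1 W F -> U x ->
  is_derive x (delta_mx 0 i) (pint F) (pint ('D_(delta_mx 0 (lshift 1 i)) F) x).
Proof.
move=> CF Ux; set D := 'D_ _ F.
have cF := fun z => @Ck_cont _ _ W 1 F z CF.
have cD := fun z => @Ck_cont _ _ W 0 D z (Ck_D _ CF).
suff H : (fun h : R => h^-1 *: ((pint F \o shift x) (h *: delta_mx 0 i) - pint F x))
    @ 0^' --> pint D x.
  by split; [apply/cvg_ex; exists (pint D x)|exact: cvg_lim H].
apply/cvgrPdist_le => e e0.
have nU : \forall y \near x, U y by exact: open_nbhs_nbhs.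
have := near_and nU (tube e0 cD Ux).
move=> /nbhs_ballP[d /= d0 xd0].
have xd y : ball x d y -> U y /\ forall t, 0 <= t <= 1 -> `|D (pt x t) - D (pt y t)| <= e.
  exact: xd0.
have : \forall h \near (0 : R)^', `|h| < d.
  by apply: dnbhs0_lt.
have : \forall h \near (0 : R)^', h != 0 by exact: nbhs_dnbhs_neq.
apply: filterS2 => h hn0 hd.
have B s : 0 <= s <= 1 -> ball x d (x + (s * h) *: delta_mx 0 i).
  move=> /andP[s0 s1]; apply/rV_ballP => // j; rewrite !mxE eqxx/=.
  rewrite opprD addrA subrr sub0r normrN.
  apply: le_lt_trans hd; rewrite !normrM (ger0_norm s0).
  by case: (_ == _); rewrite ?normr1 ?normr0 ?mulr0 ?mulr1// ler_piMl.
have Uh : U (x + h *: delta_mx 0 i).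
  have b1 : 0 <= (1 : R) <= 1 by rewrite ler01 lexx.
  by have := B 1 b1; rewrite mul1r => /xd[].
have cFx := pt_slice_continuous cF Ux; have cDx := pt_slice_continuous cD Ux.
have : `|pint F (x + h *: delta_mx 0 i) - (pint F x + h * pint D x)| <= e * `|h|.
  rewrite -int01_linear//; apply: int01_dist.
  - exact: pt_slice_continuous.
  - move=> t It; apply: continuousD; first exact: cFx.
    by apply: continuousM; [exact: cst_continuous|exact: cDx].
  - move=> t t01; rewrite pt_shift opprD addrA [h * _]mulrC.
    apply: mvt_bound => s s01; rewrite -pt_shift.
    have [Uy Hy] := xd _ (B s s01); split; first exact: (Ck_der _ CF (UW Uy t01)).
    by rewrite distrC; exact: Hy.
move=> H; rewrite /= [h *: _ + x]addrC.
rewrite -[leLHS](mulfK (_ : `|h| != 0)) ?normr_eq0// ler_pdivrMr ?normr_gt0//.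
rewrite -normrM; apply: le_trans H; rewrite le_eqVlt; apply/orP; left; apply/eqP.
rewrite distrC mulrBl; congr (`|_|); rewrite -[_ *: _]/(_ * _).
by rewrite mulrAC mulVf// mul1r; ring.
Qed.

Lemma Ck_pint k F : Ck k.+1 W F -> Ck k U (pint F).
Proof.
elim: k F => [|k IH] F CF.
  by split=> // x Ux; apply: pint_continuous => // z Wz; exact: (Ck_cont CF Wz).
have C1 := Ck1 CF.
apply: CkS => [x Ux|x i Ux|i].
- by apply: pint_continuous => // z Wz; exact: (Ck_cont CF Wz).
- by have [] := pint_derive i C1 Ux.
- apply: (Ck_eq oU _ (IH _ (Ck_D (lshift 1 i) CF))) => x Ux.
  by have [_ ->] := pint_derive i C1 Ux.
Qed.

End integrand.
End parametric_integral.

(** * Smooth germs *)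

Section germs.
Context {R : realType}.

Lemma open_preimage (T S : topologicalType) (U : set T) (V : set S) (c : T -> S) :
  open U -> open V -> (forall x, U x -> {for x, continuous c}) ->
  open (U `&` c @^-1` V).
Proof.
move=> oU oV cc; rewrite openE => x [Ux Vcx].
have nU : nbhs x U by exact: open_nbhs_nbhs.
have nV : nbhs (c x) V by exact: open_nbhs_nbhs.
exact: filterI nU (cc x Ux V nV).
Qed.

Lemma open_neq0 : open [set y : R | y != 0].
Proof. exact: (@open_neq R 0). Qed.

Definition smooth_on n p q (U : set 'rV[R]_n) (M : 'rV[R]_n -> 'M[R]_(p, q)) :=
  forall k i j, Ck k U (fun x => M x i j).

Section smooth_on_theory.
Variables (n : nat) (U : set 'rV[R]_n).
Hypothesis oU : open U.

Lemma smooth_on_continuous p q (M : 'rV[R]_n -> 'M[R]_(p, q)) x :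
  smooth_on U M -> U x -> {for x, continuous M}.
Proof.
by move=> CM Ux; apply: mx_continuous => i j; exact: (Ck_cont (CM 0%N i j) Ux).
Qed.

Lemma Ck_det k p (M : 'rV[R]_n -> 'M[R]_p) :
  (forall i j, Ck k U (fun x => M x i j)) -> Ck k U (fun x => \det (M x)).
Proof.
move=> CM; rewrite /determinant; apply: Ck_sum => // s _; apply: Ck_mul => //.
  exact: Ck_cst.
by apply: Ck_prod => // i _.
Qed.

(** Cramer's rule: the entries of the inverse are cofactors, polynomial in the entries of [M],
    divided by the determinant. *)
Lemma Ck_invmx k p (M : 'rV[R]_n -> 'M[R]_p) :
  (forall i j, Ck k U (fun x => M x i j)) -> (forall x, U x -> M x \in unitmx) ->
  forall i j, Ck k U (fun x => invmx (M x) i j).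
Proof.
move=> CM uM i j.
apply: (Ck_eq oU (f := fun x => (\det (M x))^-1 * \adj (M x) i j)).
  by move=> x Ux; rewrite /invmx (uM _ Ux) !mxE.
apply: Ck_mul => //.
  apply: Ck_inv => //; last exact: Ck_det.
  by move=> x /uM; rewrite unitmxE unitfE.
apply: (Ck_eq oU (f := fun x => (-1) ^+ (j + i) * \det (row' j (col' i (M x))))).
  by move=> x Ux; rewrite mxE.
apply: Ck_mul => //; first exact: Ck_cst.
apply: Ck_det => a b.
by apply: (Ck_eq oU _ (CM (lift j a) (lift i b))) => x Ux; rewrite !mxE.
Qed.

End smooth_on_theory.

(** The bridge to the [Ck] calculus. In one direction the induction on [k] treats all [partial s M]
    together, since differentiating one of them gives [partial (a :: s) M]; in the other, each
    derivative in [s] uses up one order of [Ck]. *)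
Lemma smooth_germP n p q (M : 'rV[R]_n -> 'M[R]_(p, q)) :
  smooth_germ M <-> exists U : set 'rV[R]_n, [/\ open U, U 0 & smooth_on U M].
Proof.
split=> [|[U [oU U0 CM]]].
  rewrite /smooth_germ -nbhs_nearE nbhsE => -[U [oU U0] UM].
  exists U; split=> // k i j.
  suff K : forall s : seq 'I_n, Ck k U (fun x => partial s M x i j) by exact: (K [::]).
  elim: k => [|k IH] s.
    split=> // x Ux; apply: (@continuous_comp _ _ _ (partial s M) (fun N => N i j)).
      by have [] := UM x Ux s.
    exact: coord_continuous.
  have dM a x : U x -> derivable (partial s M) x (delta_mx 0 a).
    by move=> Ux; have [_] := UM x Ux s.
  apply: CkS => [x Ux|x a Ux|a].
  - exact: (Ck_cont (IH s) Ux).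
  - exact: (derivable_mxP _ _ _).1 (dM a x Ux) i j.
  - apply: (Ck_eq oU _ (IH (a :: s))) => x Ux /=.
    by rewrite derive_mx ?mxE//; exact: dM.
have P (s : seq 'I_n) : forall i j k, Ck k U (fun x => partial s M x i j).
  elim: s => [|a s IH] i j k; first exact: CM.
  apply: (Ck_eq oU _ (Ck_D a (IH i j k.+1))) => x Ux /=.
  rewrite derive_mx ?mxE//; apply/derivable_mxP => i' j'.
  exact: (Ck_der a (IH i' j' 1%N) Ux).
have : \forall x \near (0 : 'rV[R]_n), U x by exact: open_nbhs_nbhs.
apply: near_imp => x Ux s; split.
  by apply: mx_continuous => i j; exact: (Ck_cont (P s i j 0%N) Ux).
by move=> a; apply/derivable_mxP => i j; exact: (Ck_der a (P s i j 1%N) Ux).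
Qed.

Definition sgerm n (f : 'rV[R]_n -> R) : Prop :=
  exists U : set 'rV[R]_n, [/\ open U, U 0 & forall k, Ck k U f].

Lemma open_near_subset n (P : 'rV[R]_n -> Prop) : (\forall x \near (0 : 'rV[R]_n), P x) ->
  exists U : set 'rV[R]_n, [/\ open U, U 0 & forall x, U x -> P x].
Proof. by rewrite -nbhs_nearE nbhsE => -[U [oU U0] UP]; exists U. Qed.

(** Each entry has its own neighborhood; being finitely many, they contain a common open one. *)
Lemma smooth_germ_entry n p q (M : 'rV[R]_n -> 'M[R]_(p, q)) :
  smooth_germ M <-> forall i j, sgerm (fun x => M x i j).
Proof.
split=> [/smooth_germP[U [oU U0 CM]] i j|sM].
  by exists U; split=> // k; exact: CM.
apply/smooth_germP.
pose F (a : 'I_p * 'I_q) := projT1 (cid (sM a.1 a.2)).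
have HF a : [/\ open (F a), F a 0 & forall k, Ck k (F a) (fun x => M x a.1 a.2)].
  exact: (projT2 (cid (sM a.1 a.2))).
have : \forall x \near (0 : 'rV[R]_n), forall a, F a x.
  by apply: near_forall => a; have [oF F0 _] := HF a; exact: open_nbhs_nbhs.
move=> /open_near_subset[U [oU U0 UF]]; exists U; split=> // k i j.
have [_ _ /(_ k)] := HF (i, j); apply: Ck_sub => x Ux; exact: UF.
Qed.

Lemma sgerm2 n (f g : 'rV[R]_n -> R) : sgerm f -> sgerm g ->
  exists U : set 'rV[R]_n, [/\ open U, U 0, forall k, Ck k U f & forall k, Ck k U g].
Proof.
move=> [U [oU U0 Cf]] [V [oV V0 Cg]]; exists (U `&` V).
split=> //; first exact: openI.
  by move=> k; apply: Ck_sub (Cf k); exact: subIsetl.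
by move=> k; apply: Ck_sub (Cg k); exact: subIsetr.
Qed.

Lemma sgerm_cst n c : sgerm (fun _ : 'rV[R]_n => c).
Proof. by exists setT; split=> // [|k]; [exact: openT|apply: Ck_cst; exact: openT]. Qed.

Lemma sgerm_coord n j : sgerm (fun x : 'rV[R]_n => x 0 j).
Proof. by exists setT; split=> // [|k]; [exact: openT|apply: Ck_coord; exact: openT]. Qed.

Lemma sgerm_add n (f g : 'rV[R]_n -> R) : sgerm f -> sgerm g -> sgerm (fun x => f x + g x).
Proof.
move=> sf sg; have [U [oU U0 Cf Cg]] := sgerm2 sf sg.
by exists U; split=> // k; exact: Ck_add.
Qed.

Lemma sgerm_opp n (f : 'rV[R]_n -> R) : sgerm f -> sgerm (fun x => - f x).
Proof. by move=> [U [oU U0 Cf]]; exists U; split=> // k; exact: Ck_opp. Qed.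

Lemma sgerm_mul n (f g : 'rV[R]_n -> R) : sgerm f -> sgerm g -> sgerm (fun x => f x * g x).
Proof.
move=> sf sg; have [U [oU U0 Cf Cg]] := sgerm2 sf sg.
by exists U; split=> // k; exact: Ck_mul.
Qed.

Lemma sgerm_eq n (f g : 'rV[R]_n -> R) : f =1 g -> sgerm f -> sgerm g.
Proof. by move=> /funext ->. Qed.

Lemma sgerm_continuous n (f : 'rV[R]_n -> R) : sgerm f -> {for 0, continuous f}.
Proof. by move=> [U [oU U0 /(_ 0%N)/Ck_cont]]; apply. Qed.

Lemma sgerm_inv n (f : 'rV[R]_n -> R) : f 0 != 0 -> sgerm f -> sgerm (fun x => (f x)^-1).
Proof.
move=> f0 [U [oU U0 Cf]].
have oW : open (U `&` f @^-1` [set y | y != 0]).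
  apply: (open_preimage oU open_neq0) => x Ux.
  exact: (Ck_cont (Cf 0%N) Ux).
exists (U `&` f @^-1` [set y | y != 0]); split=> // k.
apply: Ck_inv => // [x []//|].
by apply: Ck_sub (Cf k); exact: subIsetl.
Qed.

Lemma sgerm_sum n (I : Type) (r : seq I) (P : pred I) (F : I -> 'rV[R]_n -> R) :
  (forall i, P i -> sgerm (F i)) -> sgerm (fun x => \sum_(i <- r | P i) F i x).
Proof.
move=> sF; elim: r => [|a r IH].
  by apply: (sgerm_eq _ (sgerm_cst _ 0)) => x; rewrite big_nil.
have [Pa|Pa] := boolP (P a); last first.
  by apply: (sgerm_eq _ IH) => x; rewrite big_cons (negbTE Pa).
by apply: (sgerm_eq _ (sgerm_add (sF a Pa) IH)) => x; rewrite big_cons Pa.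
Qed.

Section matrix_germs.
Variable n : nat.
Local Notation germ p q := ('rV[R]_n -> 'M[R]_(p, q)).

Lemma smooth_germ_continuous p q (M : germ p q) : smooth_germ M ->
  {for 0, continuous M}.
Proof. by move=> /smooth_germP[U [_ U0 CM]]; exact: smooth_on_continuous CM U0. Qed.

Lemma smooth_germ_cst p q (A : 'M[R]_(p, q)) : smooth_germ (fun _ : 'rV[R]_n => A).
Proof. by apply/smooth_germ_entry => i j; exact: sgerm_cst. Qed.

Lemma smooth_germ_id : smooth_germ (fun x : 'rV[R]_n => x).
Proof. by apply/smooth_germ_entry => i j; rewrite (ord1 i); exact: sgerm_coord. Qed.

Lemma smooth_germ_add p q (M N : germ p q) :
  smooth_germ M -> smooth_germ N -> smooth_germ (fun x => M x + N x).
Proof.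
move=> /smooth_germ_entry sM /smooth_germ_entry sN; apply/smooth_germ_entry => i j.
by apply: (sgerm_eq _ (sgerm_add (sM i j) (sN i j))) => x; rewrite mxE.
Qed.

Lemma smooth_germ_opp p q (M : germ p q) :
  smooth_germ M -> smooth_germ (fun x => - M x).
Proof.
move=> /smooth_germ_entry sM; apply/smooth_germ_entry => i j.
by apply: (sgerm_eq _ (sgerm_opp (sM i j))) => x; rewrite mxE.
Qed.

Lemma smooth_germ_mul p q r (M : germ p q) (N : germ q r) :
  smooth_germ M -> smooth_germ N -> smooth_germ (fun x => M x *m N x).
Proof.
move=> /smooth_germ_entry sM /smooth_germ_entry sN; apply/smooth_germ_entry => i j.
apply: (@sgerm_eq _ (fun x => \sum_k M x i k * N x k j)) => [x|].
  by rewrite mxE.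
by apply: sgerm_sum => k _; exact: sgerm_mul.
Qed.

Lemma near_unitmx p (M : germ p p) : smooth_germ M -> M 0 \in unitmx ->
  \forall x \near (0 : 'rV[R]_n), M x \in unitmx.
Proof.
move=> /smooth_germP[U [oU U0 CM]] M0.
have cd : {for 0, continuous (fun x => \det (M x))}.
  exact: (Ck_cont (Ck_det oU (CM 0%N)) U0).
have : \forall x \near (0 : 'rV[R]_n), \det (M x) != 0.
  have : \forall y \near \det (M 0), y != 0.
    by apply: open_nbhs_nbhs; split; [exact: open_neq0|rewrite -unitfE -unitmxE].
  exact: cd.
by apply: near_imp => x; rewrite unitmxE unitfE.
Qed.

Lemma smooth_germ_invmx p (M : germ p p) : smooth_germ M -> M 0 \in unitmx ->
  smooth_germ (fun x => invmx (M x)).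
Proof.
move=> sM M0; have /open_near_subset[V [oV V0 uM]] := near_unitmx sM M0.
move: sM => /smooth_germP[U [oU U0 CM]].
apply/smooth_germP; exists (U `&` V); split=> //; first exact: openI.
move=> k i j; apply: Ck_invmx => [|a b|x [_ /uM]//]; first exact: openI.
by apply: Ck_sub (CM k a b); exact: subIsetl.
Qed.

End matrix_germs.

Lemma near_comp m n (u : 'rV[R]_m -> 'rV[R]_n) (P : 'rV[R]_n -> Prop) :
  smooth_germ u -> u 0 = 0 ->
  (\forall y \near (0 : 'rV[R]_n), P y) -> \forall x \near (0 : 'rV[R]_m), P (u x).
Proof.
move=> su u0 nP; have := smooth_germ_continuous su.
by move=> cu; apply: cu; rewrite u0.
Qed.

Lemma smooth_germ_comp m n p q (u : 'rV[R]_m -> 'rV[R]_n)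
    (M : 'rV[R]_n -> 'M[R]_(p, q)) :
  smooth_germ u -> u 0 = 0 -> smooth_germ M -> smooth_germ (fun x => M (u x)).
Proof.
move=> /smooth_germP[U [oU U0 Cu]] u0 /smooth_germP[V [oV V0 CM]].
have oW : open (U `&` u @^-1` V).
  by apply: open_preimage => // x Ux; exact: smooth_on_continuous Cu Ux.
apply/smooth_germP; exists (U `&` u @^-1` V); split=> //.
  by split=> //=; rewrite u0.
move=> k i j.
apply: (@Ck_comp _ _ _ _ _ V u (fun y => M y i j)) => // [a|x []//].
by apply: Ck_sub (Cu k 0 a); exact: subIsetl.
Qed.

End germs.

(** * Hadamard's lemma *)

Section hadamard.
Context {R : realType}.
Local Notation I01 := (`[0%R, 1%R]%classic : set R).
Local Notation "'\int01' f" := (\int[lebesgue_measure]_(t in I01) f t)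
  (at level 10).

Lemma cont01_sum n (a : 'I_n -> R -> R) (w : 'I_n -> R) (r : seq 'I_n) :
  (forall j, cont01 (a j)) -> cont01 (fun t => \sum_(j <- r) a j t * w j).
Proof.
move=> ca t It; elim: r => [|j r IH].
  rewrite (_ : (fun _ => _) = fun=> 0); first exact: cst_continuous.
  by apply/funext => s; rewrite big_nil.
rewrite (_ : (fun _ => _) = (fun s => a j s * w j + \sum_(k <- r) a k s * w k)).
  apply: continuousD => //; apply: continuousM; first exact: ca.
  exact: cst_continuous.
by apply/funext => s; rewrite big_cons.
Qed.

Lemma int01_sum n (a : 'I_n -> R -> R) (w : 'I_n -> R) :
  (forall j, cont01 (a j)) ->
  \int01 (fun t => \sum_j a j t * w j) = \sum_j \int01 (a j) * w j.
Proof.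
move=> ca; elim: (index_enum _) => [|j r IH].
  rewrite big_nil -[RHS](int01_cst 0); congr Rintegral.
  by apply/funext => t; rewrite big_nil.
rewrite big_cons -IH addrC [_ * w j]mulrC -int01_linear//; last exact: cont01_sum.
congr Rintegral; apply/funext => t.
by rewrite big_cons addrC [w j * _]mulrC.
Qed.

Lemma int01_FTC (phi psi : R -> R) :
  (forall t : R, 0 <= t <= 1 -> is_derive t 1 phi (psi t)) -> cont01 psi ->
  \int01 psi = phi 1 - phi 0.
Proof.
move=> dphi cpsi.
have cphi (t : R) : 0 <= t <= 1 -> {for t, continuous phi}.
  move=> t01; apply: differentiable_continuous.
  by apply/derivable1_diffP; have [] := dphi t t01.
rewrite /Rintegral (@continuous_FTC2 _ psi phi 0 1)//.
- by apply: continuous_in_subspaceT => t /set_mem; exact: cpsi.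
- split.
  + move=> t; rewrite in_itv/= => /andP[t0 t1].
    have t01 : 0 <= t <= 1 by rewrite !ltW.
    by have [] := dphi t t01.
  + by apply: cvg_at_right_filter; apply: cphi; rewrite lexx ler01.
  + by apply: cvg_at_left_filter; apply: cphi; rewrite lexx ler01.
- move=> t; rewrite in_itv/= => /andP[t0 t1].
  have t01 : 0 <= t <= 1 by rewrite !ltW.
  by rewrite derive1E; have [_ ->] := dphi t t01.
Qed.

(** [H x] is the integral over [t] in [0,1] of the Jacobian of [f] at [u x + t (v x - u x)]. The
    fundamental theorem of calculus gives the identity, and differentiation under the integral the
    smoothness. Over [x = 0] the segment is the single point 0, whence the value of [H 0]. *)
Theorem hadamard m n p (f : 'rV[R]_n -> 'cV[R]_p) (u v : 'rV[R]_m -> 'rV[R]_n) :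
  smooth_germ f -> smooth_germ u -> smooth_germ v -> u 0 = 0 -> v 0 = 0 ->
  exists H : 'rV[R]_m -> 'M[R]_(p, n),
    [/\ smooth_germ H,
        \forall x \near (0 : 'rV[R]_m), f (v x) - f (u x) = H x *m (v x - u x)^T &
        H 0 = \matrix_(i, j) 'D_(delta_mx 0 j) (fun y => f y i 0) 0].
Proof.
move=> /smooth_germP[V [oV V0 Cf]] su sv u0 v0.
have [/smooth_germP[U1 [oU1 U10 Cu]] /smooth_germP[U2 [oU2 U20 Cv]]] := (su, sv).
have nV : nbhs (0 : 'rV[R]_n) V by exact: open_nbhs_nbhs.
have [d /= d0 dV] := (nbhs_ballP _ _).1 nV.
(* Both endpoints are kept in a ball inside [V]; by convexity the whole segment then lies in [V]. *)
have : \forall x \near (0 : 'rV[R]_m), [/\ U1 x, U2 x, ball 0 d (u x) & ball 0 d (v x)].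
  have B : \forall y \near (0 : 'rV[R]_n), ball 0 d y by exact: nbhsx_ballx.
  have N1 : \forall x \near (0 : 'rV[R]_m), U1 x by exact: open_nbhs_nbhs.
  have N2 : \forall x \near (0 : 'rV[R]_m), U2 x by exact: open_nbhs_nbhs.
  apply: near_imp2 (near_and N1 N2) (near_and (near_comp su u0 B) (near_comp sv v0 B)).
  by move=> x [? ?] [? ?].
move=> /open_near_subset[U [oU U0 HU]].
(* The segment from [u x] to [v x] as one map of the joint variable [(x, t)], so that [Ck_comp]
   applies to the integrand. *)
pose c (z : 'rV[R]_(m + 1)) :=
  u (lsubmx z) + (rsubmx z 0 0) *: (v (lsubmx z) - u (lsubmx z)).
have c_pt x t : c (pt x t) = u x + t *: (v x - u x).
  by rewrite /c /pt row_mxKl row_mxKr !mxE eqxx mulr1n.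
pose W0 : set 'rV[R]_(m + 1) := setT `&` lsubmx @^-1` U.
have Cl k j : Ck k setT (fun z : 'rV[R]_(m + 1) => (lsubmx z) 0 j).
  apply: (Ck_eq openT _ (Ck_coord openT k (lshift 1 j))) => z _.
  by rewrite mxE.
have oW0 : open W0.
  apply: (open_preimage openT oU) => z _; apply: mx_continuous => i j; rewrite (ord1 i).
  exact: (Ck_cont (Cl 0%N j) I).
have Cl0 k j : Ck k W0 (fun z : 'rV[R]_(m + 1) => (lsubmx z) 0 j).
  by apply: Ck_sub (Cl k j).
have Ccu k j : Ck k W0 (fun z => u (lsubmx z) 0 j).
  apply: (Ck_comp (f := fun y => u y 0 j) (u := lsubmx) oW0 oU1) => //.
  by move=> z [_ /HU[]].
have Ccv k j : Ck k W0 (fun z => v (lsubmx z) 0 j).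
  apply: (Ck_comp (f := fun y => v y 0 j) (u := lsubmx) oW0 oU2) => //.
  by move=> z [_ /HU[]].
have Cc : smooth_on W0 c.
  move=> k i j; rewrite (ord1 i).
  apply: (Ck_eq oW0 (f := fun z => u (lsubmx z) 0 j +
     z 0 (rshift m 0) * (v (lsubmx z) 0 j - u (lsubmx z) 0 j))).
    by move=> z _; rewrite !mxE.
  apply: Ck_add => //; apply: Ck_mul => //; first exact: Ck_coord.
  by apply: Ck_add => //; exact: Ck_opp.
pose W := W0 `&` c @^-1` V.
have oW : open W.
  by apply: (open_preimage oW0 oV) => z; exact: smooth_on_continuous Cc.
have UW x t : U x -> 0 <= t <= 1 -> W (pt x t).
  move=> Ux t01; split; first by split=> //; rewrite /= /pt row_mxKl.
  rewrite /= c_pt; apply: dV; apply/rV_ballP => // j.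
  have [_ _ /rV_ballP-/(_ d0 j) uj /rV_ballP-/(_ d0 j) vj] := HU x Ux.
  have := convex_norm_lt uj vj t01; congr (`|_| < _).
  by rewrite !mxE; ring.
pose F i j (z : 'rV[R]_(m + 1)) := 'D_(delta_mx 0 j) (fun y => f y i 0) (c z).
have CF k i j : Ck k W (F i j).
  apply: (Ck_comp (f := 'D_(delta_mx 0 j) (fun y => f y i 0)) (u := c) oW oV).
  - by move=> a; apply: Ck_sub (Cc k 0 a) => z [].
  - exact: Ck_D j (Cf k.+1 i 0).
  - by move=> z [].
exists (fun x => \matrix_(i, j) pint (F i j) x); split.
- apply/smooth_germP; exists U; split=> // k i j.
  apply: (Ck_eq oU (f := pint (F i j))); first by move=> x _; rewrite mxE.
  exact: (Ck_pint oU UW (CF k.+1 i j)).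
- have : \forall x \near (0 : 'rV[R]_m), U x by exact: open_nbhs_nbhs.
  apply: near_imp => x Ux; apply/matrixP => i j; rewrite (ord1 j) !mxE {j}.
  set w := v x - u x.
  have uwV t : 0 <= t <= 1 -> V (u x + t *: w).
    by move=> t01; have [_] := UW x t Ux t01; rewrite /= c_pt.
  have ca j : cont01 (fun t => F i j (pt x t)).
    apply: (pt_slice_continuous UW) => // z Wz; exact: (Ck_cont (CF 0%N i j) Wz).
  transitivity (\sum_j \int01 (fun t => F i j (pt x t)) * w 0 j); last first.
    by apply: eq_bigr => j _; rewrite !mxE.
  have dphi (t : R) : 0 <= t <= 1 -> is_derive t 1 (fun t => f (u x + t *: w) i 0)
      (\sum_j F i j (pt x t) * w 0 j).
    move=> t01; have [df dfE] := C1_diff oV (Cf 1%N i 0) (uwV t t01).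
    have := is_derive_line (@diff_derivable _ _ _ _ _ w df).
    rewrite (deriveE _ df) dfE /lform.
    by under eq_bigr => j _ do rewrite -c_pt.
  have cs := @cont01_sum n (fun j t => F i j (pt x t)) (fun j => w 0 j) (index_enum _) ca.
  have := int01_FTC dphi cs; rewrite int01_sum// => ->.
  by rewrite scale1r scale0r addr0 [u x + w]addrC subrK.
- apply/matrixP => i j; rewrite !mxE /pint.
  rewrite -[RHS]int01_cst; congr Rintegral; apply/funext => t.
  by rewrite /F c_pt u0 v0 subrr scaler0 addr0.
Qed.

End hadamard.

(** * The inverse function theorem *)

(* Completeness and norm of matrices, once more, to have their join declared. *)
HB.instance Definition _ (R : realType) m n :=
  Uniform_isComplete.Build 'M[R]_(m, n) (@cauchy_cvg 'M[R]_(m, n)).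

Section inverse_function.
Context {R : realType}.

Definition jac m n (u : 'rV[R]_m -> 'rV[R]_n) (x : 'rV[R]_m) : 'M[R]_(m, n) :=
  \matrix_(i, j) 'D_(delta_mx 0 i) (fun y => u y 0 j) x.

Lemma mulmxr_continuous m n (B : 'M[R]_(m, n)) :
  continuous (fun v : 'rV[R]_m => v *m B).
Proof.
move=> v; apply: mx_continuous => i j; rewrite (ord1 i).
have C : Ck 0 setT (fun v : 'rV[R]_m => \sum_k v 0 k * B k j).
  apply: (Ck_sum openT) => k _; apply: (Ck_mul openT).
    exact: (Ck_coord openT).
  exact: (Ck_cst openT).
rewrite (_ : (fun _ => _) = (fun v : 'rV[R]_m => \sum_k v 0 k * B k j)).
  exact: (Ck_cont C I).
by apply/funext => w; rewrite mxE.
Qed.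

Lemma norm_coord n (x : 'rV[R]_n) j : `|x 0 j| <= `|x|.
Proof. by move: j; apply/rV_normP. Qed.

Lemma sum_norm_coord n (x : 'rV[R]_n) : \sum_k `|x 0 k| <= n%:R * `|x|.
Proof.
apply: (@le_trans _ _ (\sum_(k < n) `|x|)).
  by apply: ler_sum => k _; exact: norm_coord.
by rewrite sumr_const card_ord mulr_natl.
Qed.

(** Banach's theorem on the closed ball of radius [r]. The map [x -> phi x + w] preserves it because
    [phi x] and [w] both have norm at most [r / 2]. *)
Lemma half_contraction_fixpoint n (phi : 'rV[R]_n -> 'rV[R]_n) (r : R) (w : 'rV[R]_n) :
  0 < r -> (forall a b, `|a| <= r -> `|b| <= r -> `|phi b - phi a| <= 2^-1 * `|b - a|) ->
  phi 0 = 0 -> `|w| <= r / 2 -> exists2 x, `|x| <= r & x = phi x + w.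
Proof.
move=> r0 lphi phi0 wr; pose K : set 'rV[R]_n := [set x | `|x| <= r].
pose T x := phi x + w.
have TK : {homo T : x / K x >-> K x}.
  move=> x Kx; rewrite /K /T /=; apply: le_trans (ler_normD _ _) _.
  have := lphi 0 x; rewrite normr0 phi0 !subr0 => /(_ (ltW r0) Kx) H.
  rewrite (splitr r) lerD//; apply: le_trans H _.
  by rewrite mulrC ler_pM2r ?invr_gt0.
pose hT : isFun _ _ K K T := isFun.Build _ _ _ _ _ TK.
pose T' : {fun K >-> K} := HB.pack T hT.
have cT : is_contraction T'.
  have q0 : 0 <= 2^-1 :> R by rewrite invr_ge0.
  exists (NngNum q0); split=> /=; first by rewrite invf_lt1// ltr1n.
  move=> [x y] /= [Kx Ky]; rewrite /T opprD addrACA subrr addr0.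
  exact: lphi.
have clK : closed K.
  have -> : K = (fun x : 'rV[R]_n => `|x|) @^-1` [set y | y <= r] by [].
  by apply: preimage_closed (@closed_le _ r) => x _; exact: norm_continuous.
have [|x Kx E] := @banach_fixed_point R 'rV[R]_n K T' cT clK.
  by exists 0; rewrite /K /= normr0 ltW.
by exists x.
Qed.

End inverse_function.

Section inverse_function.
Context {R : realType}.

Lemma near_norm_lt n (f : R -> 'rV[R]_n) (c d : R) : 0 < d ->
  (forall t, `|f t| <= c * `|t|) -> \forall t \near (0 : R)^', `|f t| < d.
Proof.
move=> d0 fc.
have c1 : 0 < `|c| + 1 by rewrite ltr_wpDl.
have : \forall t \near (0 : R)^', `|t| < d / (`|c| + 1).
  by apply: dnbhs0_lt; rewrite divr_gt0.
apply: filterS => t td; apply: le_lt_trans (fc t) _.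
move: td; rewrite ltr_pdivlMr// => td.
apply: le_lt_trans td; rewrite mulrC ler_wpM2l//.
by rewrite (le_trans (ler_norm c))// lerDl.
Qed.

(* By the Lipschitz bound on [g], the difference quotient [q] of [g] satisfies
   [q *m jac F a = e + o(1)]. *)
Lemma inverse_path_derive n (U : set 'rV[R]_n) (F : 'rV[R]_n -> 'rV[R]_n)
    (g : R -> 'rV[R]_n) (a e : 'rV[R]_n) (c : R) :
  open U -> smooth_on U F -> U a -> jac F a \in unitmx -> 0 <= c ->
  (forall t, `|g t - a| <= c * `|t|) ->
  (\forall t \near (0 : R)^', F (g t) = F a + t *: e) ->
  (t^-1 *: (g t - a)) @[t --> (0 : R)^'] --> e *m invmx (jac F a).
Proof.
move=> oU CF Ua uJ c0 lg Fg.
suff H : (t^-1 *: (g t - a) *m jac F a) @[t --> (0 : R)^'] --> e.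
  have K := cvg_comp _ _ H (@mulmxr_continuous R _ _ (invmx (jac F a)) e).
  rewrite (_ : (fun _ => _) = (fun v : 'rV[R]_n => v *m invmx (jac F a)) \o
     (fun t => t^-1 *: (g t - a) *m jac F a))//.
  by apply/funext => t /=; rewrite mulmxK.
apply/cvgrPdist_le => eps eps0.
(* [n * c * |t|] bounds the sum of the coordinates of [g t - a]; the [+ 1] keeps the denominator
   positive. *)
have C0 : 0 < n%:R * c + 1 by rewrite ltr_wpDl// mulr_ge0.
have e0 : 0 < eps / (n%:R * c + 1) by rewrite divr_gt0.
have : \forall z \near a, U z /\ forall p : 'I_n * 'I_n,
    `|'D_(delta_mx 0 p.1) (fun y => F y 0 p.2) z - jac F a p.1 p.2| <= eps / (n%:R * c + 1).
  apply: near_and; first exact: open_nbhs_nbhs.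
  apply: near_forall => -[i k] /=; rewrite mxE.
  have cD := Ck_cont (Ck_D i (CF 1%N 0 k)) Ua.
  move: cD => /cvgrPdist_le /(_ _ e0).
  by apply: near_imp => z; rewrite distrC.
move=> /nbhs_ballP[d /= d0 ad].
have nd := near_norm_lt d0 lg.
have nt : \forall t \near (0 : R)^', t != 0 by exact: nbhs_dnbhs_neq.
apply: filterS3 nd nt Fg => t gd t0 Ft.
apply/rV_normP; first exact: ltW.
move=> k.
have gb : ball a d (a + (g t - a)).
  apply/rV_ballP => // j; rewrite distrC [a + _]addrC subrK.
  have := norm_coord (g t - a) j; rewrite !mxE => /le_lt_trans; exact.
have := @mvt_ball R n (fun y => F y 0 k) a a (g t - a) (fun i => jac F a i k) d
   (eps / (n%:R * c + 1)) d0 _ (ballxx _ d0) gb.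
move=> /(_ _)/wrap[].
  move=> z i zd; have [Uz Dz] := ad z zd.
  split; first exact: (Ck_der i (CF 1%N 0 k) Uz).
  exact: (Dz (i, k)).
rewrite [a + _]addrC subrK Ft => B.
rewrite -(ler_pM2l (_ : 0 < `|t|)) ?normr_gt0// -normrM.
have -> : t * (e - t^-1 *: (g t - a) *m jac F a) 0 k =
   (F a + t *: e) 0 k - F a 0 k - \sum_i jac F a i k * (g t - a) 0 i.
  rewrite -scalemxAl [in LHS]mxE [in LHS]mxE [in LHS]mxE mulrBr mulrA mulfV// mul1r.
  rewrite [(F a + _) 0 k]mxE [(t *: e) 0 k]mxE.
  have E (x y z : R) : x + y - x - z = y - z by ring.
  rewrite E; congr (_ - _).
  by rewrite mxE; apply: eq_bigr => i _; rewrite mulrC.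
apply: le_trans B _.
apply: (@le_trans _ _ (eps / (n%:R * c + 1) * (n%:R * (c * `|t|)))).
  rewrite ler_wpM2l ?(ltW e0)//; apply: le_trans (sum_norm_coord _) _.
  by rewrite ler_wpM2l.
have -> : eps / (n%:R * c + 1) * (n%:R * (c * `|t|)) =
    (`|t| * eps) * ((n%:R * c) / (n%:R * c + 1)) by ring.
rewrite ler_piMr ?mulr_ge0// ?(ltW eps0)//.
by rewrite ler_pdivrMr// mul1r lerDl.
Qed.

Lemma mulmx_norm_le m n (A : 'M[R]_(m, n)) :
  exists2 C, 0 <= C & forall w : 'rV[R]_m, `|w *m A| <= C * `|w|.
Proof.
exists (\sum_j \sum_i `|A i j|) => [|w].
  by apply: sumr_ge0 => j _; apply: sumr_ge0.
apply/rV_normP; first by rewrite mulr_ge0//; do 2 (apply: sumr_ge0 => ? _).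
move=> j; rewrite (bigD1 j)//= mulrDl.
apply: (@le_trans _ _ ((\sum_i `|A i j|) * `|w|)); last first.
  by rewrite lerDl mulr_ge0//; do 2 (apply: sumr_ge0 => ? _).
rewrite mxE mulr_suml; apply: le_trans (ler_norm_sum _ _ _) _.
apply: ler_sum => i _; rewrite normrM mulrC ler_wpM2l//; exact: norm_coord.
Qed.

(** With [A] the inverse of the Jacobian at 0, [F x = y] is the fixed point equation
    [x = phi x + y *m A] for [phi x = x - F x *m A], whose Jacobian vanishes at 0. The local inverse
    is Lipschitz, hence differentiable by [inverse_path_derive], and the formula for its derivative
    then yields all higher orders. *)
Theorem inverse_function n (F : 'rV[R]_n -> 'rV[R]_n) :
  smooth_germ F -> F 0 = 0 -> jac F 0 \in unitmx ->
  exists G : 'rV[R]_n -> 'rV[R]_n, diffeo_germ F G.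
Proof.
move=> sF F0 uJ; have [U0 [oU0 U00 CF0]] := (smooth_germP _).1 sF.
have sJ : smooth_germ (jac F).
  apply/smooth_germP; exists U0; split=> // k i j.
  apply: (Ck_eq oU0 _ (Ck_D i (CF0 k.+1 0 j))) => x _.
  by rewrite mxE.
have n1 := near_unitmx sJ uJ.
set A := invmx (jac F 0).
have uA : A \in unitmx by rewrite unitmx_inv.
have [C C0 AC] := mulmx_norm_le A.
(* Chosen so that [C * eps * n <= 1/2]: [C] bounds multiplication by [A], and [n] the sum of
   coordinates in [mvt_ball]. Jacobian entries within [eps] of those at 0 then make [phi] a
   half-contraction. *)
pose eps : R := 2^-1 / (C * n%:R + 1).
have K0 : 0 < C * n%:R + 1 by rewrite ltr_wpDl// mulr_ge0.
have eps0 : 0 < eps by rewrite divr_gt0// invr_gt0.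
have Ceps : C * (eps * n%:R) <= 2^-1.
  have -> : C * (eps * n%:R) = 2^-1 * ((C * n%:R) / (C * n%:R + 1)).
    by rewrite /eps; ring.
  by rewrite ler_piMr ?invr_ge0// ler_pdivrMr// mul1r lerDl.
have n2 : \forall z \near (0 : 'rV[R]_n), forall p : 'I_n * 'I_n,
    `|jac F z p.1 p.2 - jac F 0 p.1 p.2| <= eps.
  apply: near_forall => -[i k] /=.
  have cD := Ck_cont (Ck_D i (CF0 1%N 0 k)) U00.
  move: cD => /cvgrPdist_le /(_ _ eps0).
  by apply: near_imp => z; rewrite distrC !mxE.
have n3 : \forall z \near (0 : 'rV[R]_n), U0 z by exact: open_nbhs_nbhs.
have /open_near_subset[U [oU UU0 HU]] := near_and n3 (near_and n1 n2).
have CF : smooth_on U F by move=> k i j; apply: Ck_sub (CF0 k i j) => z /HU[].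
have uJU z : U z -> jac F z \in unitmx by move=> /HU[_ []].
have nU : nbhs (0 : 'rV[R]_n) U by exact: open_nbhs_nbhs.
have [d /= d0 dU] := (nbhs_ballP _ _).1 nU.
pose r := d / 2.
have r0 : 0 < r by rewrite divr_gt0.
have rd x : `|x| <= r -> ball (0 : 'rV[R]_n) d x.
  move=> xr; apply/rV_ballP => // j; rewrite mxE sub0r normrN.
  apply: le_lt_trans (norm_coord x j) _; apply: le_lt_trans xr _.
  by rewrite /r ltr_pdivrMr// mulr_natr mulr2n ltrDl.
have rU x : `|x| <= r -> U x by move=> /rd/dU.
pose phi x := x - F x *m A.
have phi_lip a b : `|a| <= r -> `|b| <= r -> `|phi b - phi a| <= 2^-1 * `|b - a|.
  move=> ar br.
  have -> : phi b - phi a = - ((F b - F a - (b - a) *m jac F 0) *m A).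
    rewrite mulmxBl mulmxK// mulmxBl /phi.
    by move: (F b *m A) (F a *m A) => X Y; apply/rowP => j; rewrite !mxE; ring.
  rewrite normrN; apply: le_trans (AC _) _.
  apply: le_trans (_ : C * (eps * n%:R * `|b - a|) <= _); last first.
    by rewrite mulrA ler_wpM2r.
  rewrite ler_wpM2l//.
  have eb : 0 <= eps * n%:R * `|b - a|.
    apply: mulr_ge0; last exact: normr_ge0.
    by apply: mulr_ge0; [exact: ltW|exact: ler0n].
  apply/rV_normP => // k.
  have bE : a + (b - a) = b by rewrite addrC subrK.
  have ba : ball 0 d (a + (b - a)) by rewrite bE; exact: rd.
  have := @mvt_ball R n (fun y => F y 0 k) 0 a (b - a) (fun i => jac F 0 i k) d
    eps d0 _ (rd _ ar) ba.
  move=> /(_ _)/wrap[].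
    move=> z i zd; have Uz := dU _ zd; split; first exact: (Ck_der i (CF 1%N 0 k) Uz).
    by have [_ [_ /(_ (i, k))]] := HU z Uz; rewrite [jac F z _ _]mxE.
  rewrite bE => B.
  have -> : (F b - F a - (b - a) *m jac F 0) 0 k =
     F b 0 k - F a 0 k - \sum_i jac F 0 i k * (b - a) 0 i.
    have -> : \sum_i jac F 0 i k * (b - a) 0 i = ((b - a) *m jac F 0) 0 k.
      by rewrite mxE; apply: eq_bigr => i _; rewrite mulrC.
    by move: (_ *m _) => X; rewrite !mxE.
  apply: le_trans B _; rewrite -mulrA ler_wpM2l ?(ltW eps0)//.
  exact: sum_norm_coord.
have phi0 : phi 0 = 0 by rewrite /phi F0 mul0mx subrr.
(* [b - a] is the increment of [phi] plus [(F b - F a) *m A], and the former is at most half as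
   long. This gives both injectivity of [F] and the Lipschitz bound on its inverse. *)
have F_lip a b : `|a| <= r -> `|b| <= r -> `|b - a| <= 2 * `|(F b - F a) *m A|.
  move=> ar br; have := phi_lip a b ar br.
  have -> : phi b - phi a = (b - a) - (F b - F a) *m A.
    rewrite mulmxBl /phi.
    by move: (F b *m A) (F a *m A) => X Y; apply/rowP => j; rewrite !mxE; ring.
  move=> H; have := ler_distD (b - a - (F b - F a) *m A) (b - a) 0.
  rewrite !subr0 opprB [b - a + _]addrC subrK => T.
  move: T H; set X := `|b - a|; set Y := `|_ *m A|; set Z := `|_|; lra.
(* The values [y] for which the fixed point lemma applies to [w = y *m A]; the inequality is strict
   to make [N] open. *)
pose N : set 'rV[R]_n := [set y | `|y *m A| < r / 2].
have oN : open N.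
  have -> : N = setT `&` (fun y => y *m A) @^-1` [set z | `|z| < r / 2].
    by rewrite setTI.
  apply: (open_preimage openT) => [|y _]; last exact: mulmxr_continuous.
  have -> : [set z : 'rV[R]_n | `|z| < r / 2] =
      setT `&` (fun z : 'rV[R]_n => `|z|) @^-1` [set t | t < r / 2].
    by rewrite setTI.
  by apply: (open_preimage openT) => [|y _]; [exact: open_lt|exact: norm_continuous].
have N0 : N 0 by rewrite /N /= mul0mx normr0 divr_gt0.
(* The default 0 is taken only at points with no preimage in the ball, hence never on [N]. *)
pose G y := xget 0 [set x | `|x| <= r /\ F x = y].
have GN y : N y -> `|G y| <= r /\ F (G y) = y.
  move=> Ny; rewrite /G; case: xgetP => [x -> []//|/(_ _)/= E].
  have [x xr xE] := half_contraction_fixpoint r0 phi_lip phi0 (ltW Ny).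
  exfalso; apply: (E x); split=> //.
  have : F x *m A = y *m A.
    move: xE; rewrite /phi -addrA => /(congr1 (fun z => z - x)).
    rewrite subrr [x + _]addrC addrK addrC => /esym/eqP.
    by rewrite subr_eq0 => /eqP.
  by move=> /(congr1 (mulmx^~ (invmx A))); rewrite !mulmxK.
have GF x : `|x| <= r -> N (F x) -> G (F x) = x.
  move=> xr NFx; have [Gr FG] := GN _ NFx.
  have := F_lip _ _ xr Gr; rewrite FG subrr mul0mx normr0 mulr0 normr_le0 subr_eq0.
  by move=> /eqP.
have G0 : G 0 = 0 by rewrite -[X in G X]F0 GF ?normr0 ?F0// ltW.
have NG y : N y -> U (G y) by move=> /GN[/rU].
have G_lip y y' : N y -> N y' -> `|G y' - G y| <= 2 * `|(y' - y) *m A|.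
  by move=> /GN[yr yE] /GN[yr' yE']; have := F_lip _ _ yr yr'; rewrite yE yE'.
have cG j y : N y -> {for y, continuous (fun y => G y 0 j)}.
  move=> Ny; apply: rcont_dist => e e0.
  have nN : \forall y' \near y, N y' by exact: open_nbhs_nbhs.
  have e2 : 0 < e / 2 by rewrite divr_gt0.
  have := @mulmxr_continuous R _ _ A y => /cvgrPdist_le /(_ _ e2).
  apply: near_imp2 nN => y' Ny' H; rewrite distrC.
  have := norm_coord (G y' - G y) j; rewrite !mxE => /le_trans; apply.
  apply: le_trans (G_lip _ _ Ny Ny') _.
  by rewrite mulrC -ler_pdivlMr// mulmxBl distrC.
have dG i j y : N y -> is_derive y (delta_mx 0 i) (fun y => G y 0 j)
    (invmx (jac F (G y)) i j).
  move=> Ny; set e : 'rV[R]_n := delta_mx 0 i.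
  have [Gr FG] := GN _ Ny.
  (* The path [t -> G (y + t e)], replaced by a constant outside [N] so that the Lipschitz bound
     holds for every [t]. *)
  pose g t := if `[< N (y + t *: e) >] then G (y + t *: e) else G y.
  have gN : \forall t \near (0 : R)^', N (y + t *: e).
    apply: nbhs_dnbhs.
    have ct : {for (0 : R), continuous (fun t : R => y + t *: e)}.
      by apply: continuousD; [exact: cst_continuous|exact: scalel_continuous].
    by apply: ct; rewrite scale0r addr0; exact: open_nbhs_nbhs.
  have g_lip t : `|g t - G y| <= 2 * `|e *m A| * `|t|.
    rewrite /g; case: asboolP => Nt; last by rewrite subrr normr0 !mulr_ge0.
    apply: le_trans (G_lip _ _ Ny Nt) _.
    by rewrite [y + _]addrC addrK -scalemxAl normrZ [`|t| * _]mulrC mulrA.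
  have Fg : \forall t \near (0 : R)^', F (g t) = F (G y) + t *: e.
    by apply: filterS gN => t Nt; rewrite /g asboolT// (GN _ Nt).2 FG.
  have c0 : 0 <= 2 * `|e *m A| by rewrite mulr_ge0.
  have H := inverse_path_derive oU CF (NG _ Ny) (uJU _ (NG _ Ny)) c0 g_lip Fg.
  have K : (fun h : R => h^-1 *: (((fun y => G y 0 j) \o shift y) (h *: e) - G y 0 j))
      @ 0^' --> invmx (jac F (G y)) i j.
    have -> : invmx (jac F (G y)) i j = (e *m invmx (jac F (G y))) 0 j.
      by rewrite -rowE mxE.
    apply: cvg_trans (cvg_comp _ _ H (@coord_continuous _ _ _ 0 j _)).
    apply: near_eq_cvg; apply: filterS gN => t Nt.
    by rewrite /= !mxE /g asboolT// [t *: e + y]addrC.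
  split; first by apply/cvg_ex; exists (invmx (jac F (G y)) i j).
  exact: cvg_lim K.
(* Bootstrapping: the partial derivatives of [G] are entries of the inverse of [jac F (G y)], so
   they are of class C^k as soon as [G] is, and [G] is then of class C^(k+1). *)
have CG k : forall j, Ck k N (fun y => G y 0 j).
  elim: k => [|k IH] j; first by split=> // y; exact: cG.
  apply: CkS => [y Ny|y i Ny|i].
  - exact: cG.
  - by have [] := dG i j y Ny.
  - apply: (Ck_eq oN (f := fun y => invmx (jac F (G y)) i j)).
      by move=> y Ny; have [_ ->] := dG i j y Ny.
    apply: (Ck_invmx oN (M := fun y => jac F (G y))) => [a b|y Ny]; last exact/uJU/NG.
    apply: (Ck_eq oN (f := 'D_(delta_mx 0 a) (fun y => F y 0 b) \o G)).
      by move=> y _; rewrite mxE.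
    by apply: (Ck_comp oN oU IH _ NG); exact: (Ck_D a (CF k.+1 0 b)).
exists G; split.
- by [].
- split; last exact: G0.
  apply/smooth_germP; exists N; split; [exact: oN|exact: N0|move=> k i j].
  by rewrite (ord1 i); exact: CG.
- have nN : \forall y \near (0 : 'rV[R]_n), N y by exact: open_nbhs_nbhs.
  have nr : \forall x \near (0 : 'rV[R]_n), `|x| < r by exact: nbhs0_lt.
  apply: near_imp2 nr (near_comp sF F0 nN) => x xr Nx.
  by apply: GF => //; exact: ltW.
- have nN : \forall y \near (0 : 'rV[R]_n), N y by exact: open_nbhs_nbhs.
  by apply: near_imp nN => y /GN[].
Qed.

End inverse_function.

(** * Linear algebra and permutations *)

(** The integers from 0 to [size p - 1] are distinct in [F], and too many for all of them to be
    roots. *)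
Lemma exists_nonroot (F : numDomainType) (p : {poly F}) : p != 0 -> exists t, ~~ root p t.
Proof.
move=> p0; have [/allP H|/allPn[t _ tr]] :=
  boolP (all (root p) [seq i%:R | i <- iota 0 (size p)]); last by exists t.
have := @max_poly_roots _ p [seq i%:R | i <- iota 0 (size p)] p0.
rewrite size_map size_iota ltnn => /(_ _ _)/wrap[||//]; first exact/allP.
by rewrite map_inj_uniq ?iota_uniq// => i j /eqP; rewrite eqr_nat => /eqP.
Qed.

(** With right inverses [BX] and [BY], try [P = BX + t BY]. Then [X P = 1 + t X BY] and
    [Y P = Y BX + t]. Both determinants are nonzero polynomials in [t]: the first takes the value 1
    at 0, the second is the characteristic polynomial of [- Y BX]. Any [t] that is a root of neither
    will do. *)
Lemma common_complement (F : numFieldType) m n (X Y : 'M[F]_(m, n)) :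
  row_free X -> row_free Y ->
  exists P : 'M[F]_(n, m), X *m P \in unitmx /\ Y *m P \in unitmx.
Proof.
move=> /row_freeP[BX XB] /row_freeP[BY YB].
pose p1 : {poly F} := \det (1%:M + 'X *: map_mx polyC (X *m BY)).
have p1E t : p1.[t] = \det (1%:M + t *: (X *m BY)).
  rewrite -horner_evalE -det_map_mx; congr (\det _); apply/matrixP => i j.
  by rewrite !mxE /= horner_evalE !hornerE hornerMn hornerC.
have p2E t : (char_poly (- (Y *m BX))).[t] = \det (Y *m BX + t%:M).
  rewrite -horner_evalE -det_map_mx; congr (\det _); apply/matrixP => i j.
  rewrite !mxE /= horner_evalE !hornerE hornerMn hornerX.
  by rewrite opprK addrC.
have p10 : p1 != 0.
  apply/eqP => p10; have := p1E 0.
  by rewrite p10 horner0 scale0r addr0 det1 => /eqP; rewrite eq_sym oner_eq0.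
have p20 : char_poly (- (Y *m BX)) != 0 by exact/monic_neq0/char_poly_monic.
have [t] := exists_nonroot (mulf_neq0 p10 p20).
rewrite /root hornerM mulf_eq0 negb_or p1E p2E => /andP[t1 t2].
exists (BX + t *: BY); split; rewrite unitmxE unitfE mulmxDr -scalemxAr.
  by rewrite XB.
by rewrite YB scalemx1.
Qed.

(** Here [M] is the differential of the equations and the rows of [X] span tangent directions. By
    the dimension count they span the whole kernel of the equations, and [P] is injective on that
    span; so no nonzero vector is killed by both [M] and [P]. *)
Lemma complement_left_inverse (F : fieldType) k m n (M : 'M[F]_(k, n))
    (X : 'M[F]_(m, n)) (P : 'M[F]_(n, m)) :
  row_free M -> M *m X^T = 0 -> X *m P \in unitmx -> (m + k = n)%N ->
  exists S : 'M[F]_(n, k + m), S *m col_mx M P^T = 1%:M.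
Proof.
move=> fM MX uXP mkn.
have fX : row_free X.
  by apply/row_freeP; exists (P *m invmx (X *m P)); rewrite mulmxA mulmxV.
have kerX : (kermx M^T <= X)%MS.
  have XK : (X <= kermx M^T)%MS.
    by apply/sub_kermxP; rewrite -[X]trmxK -trmx_mul MX trmx0.
  rewrite -(mxrank_leqif_sup XK) mxrank_ker mxrank_tr (eqP fX) (eqP fM).
  by rewrite -mkn addnK.
suff : row_free (row_mx M^T P).
  move=> /row_freeP[B EB]; exists B^T.
  by apply: trmx_inj; rewrite trmx_mul tr_col_mx !trmxK trmx1.
apply: inj_row_free => v; rewrite mul_mx_row -[0]row_mx0 => /eq_row_mx[vM vP].
have /submxP[c vE] : (v <= X)%MS by apply: submx_trans kerX; exact/sub_kermxP.
have : c *m (X *m P) = 0 by rewrite mulmxA -vE.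
move=> /(congr1 (mulmx^~ (invmx (X *m P)))); rewrite mulmxK// mul0mx => c0.
by rewrite vE c0 mul0mx.
Qed.

(** On the kernel of [A] the factor [1 - B A] is the identity, so it is enough that [C] be injective
    on this kernel with range in a complement of the range of [A]. After transposition, the rank
    normal form [A = L p U] provides such a matrix, [L (1 - p) U]. *)
Lemma unit_completion (F : fieldType) l (A B : 'M[F]_l) :
  exists C : 'M[F]_l, A + C *m (1%:M - B *m A) \in unitmx.
Proof.
suff [C H] : exists C : 'M[F]_l, A^T + (1%:M - A^T *m B^T) *m C \in unitmx.
  exists C^T; rewrite -unitmx_tr linearD/= trmx_mul trmxK linearB/= trmx1.
  by rewrite trmx_mul.
move: A^T B^T => {}A {}B.
pose L := col_ebase A; pose U := row_ebase A.
pose p : 'M[F]_l := pid_mx (\rank A).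
have uL : L \in unitmx by exact: col_ebase_unit.
have uU : U \in unitmx by exact: row_ebase_unit.
have AE : A = L *m p *m U by rewrite mulmx_ebase.
have pp : p *m p = p by rewrite pid_mx_id// rank_leq_row.
exists (L *m (1%:M - p) *m U); rewrite -row_free_unit; apply: inj_row_free => v.
set w := v *m (1%:M - A *m B).
rewrite mulmxDr [v *m (_ *m _)]mulmxA -/w {1}AE !mulmxA -mulmxDl.
move=> /(congr1 (mulmx^~ (invmx U))); rewrite mulmxK// mul0mx => E.
(* Multiplication by the idempotent [p] removes the summand coming from [C], so the two summands
   vanish separately. *)
have vLp : v *m L *m p = 0.
  have := congr1 (mulmx^~ p) E.
  rewrite /= mul0mx mulmxDl -[v *m L *m p *m p]mulmxA pp.
  by rewrite -[_ *m (1%:M - p) *m p]mulmxA mulmxBl mul1mx pp subrr mulmx0 addr0.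
have vA : v *m A = 0 by rewrite AE !mulmxA vLp mul0mx.
have wE : w = v by rewrite /w mulmxBr mulmx1 mulmxA vA mul0mx subr0.
move: E; rewrite vLp add0r wE mulmxBr mulmx1 vLp subr0.
by move=> /(congr1 (mulmx^~ (invmx L))); rewrite mulmxK// mul0mx.
Qed.

(** Two enumerations of [T] are matched position by position: one begins with [A], the other with
    the images under [f] in the same order. *)
Lemma perm_extension (T : finType) (f : T -> T) (A : {set T}) :
  {in A &, injective f} -> exists s : {perm T}, {in A, s =1 f}.
Proof.
move=> fA.
pose X := enum A ++ enum (~: A); pose Y := map f (enum A) ++ enum (~: (f @: A)).
have uX : uniq X.
  rewrite cat_uniq !enum_uniq/= andbT; apply/hasPn => x.
  by rewrite !mem_enum inE.
have uY : uniq Y.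
  rewrite cat_uniq enum_uniq andbT map_inj_in_uniq ?enum_uniq/=; last first.
    by move=> x y; rewrite !mem_enum; exact: fA.
  apply/hasPn => y; rewrite mem_enum inE; apply: contra => /mapP[x].
  by rewrite mem_enum => xA ->; exact: imset_f.
have inX x : x \in X by rewrite mem_cat !mem_enum inE; case: (x \in A).
have sXY : size X = size Y.
  by rewrite !size_cat size_map -!cardE cardsC -(card_in_imset fA) cardsC.
pose s x := nth x Y (index x X).
have s_inj : injective s.
  move=> x y.
  have ix : (index x X < size Y)%N by rewrite -sXY index_mem.
  have iy : (index y X < size Y)%N by rewrite -sXY index_mem.
  rewrite /s (set_nth_default y x ix) => /eqP; rewrite nth_uniq// => /eqP E.
  by have := nth_index x (inX x); rewrite E (nth_index _ (inX y)) => ->.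
exists (perm s_inj) => x xA; rewrite permE /s nth_cat size_map.
have xe : x \in enum A by rewrite mem_enum.
rewrite index_cat xe index_mem xe (nth_map x) ?index_mem// nth_index//.
Qed.

(** * Jacobians *)

Section jacobians.
Context {R : realType}.

(** Transposed with respect to [jac]: the values are columns here, so the differential acts from the
    left on [v^T]. *)
Definition cjac n p (f : 'rV[R]_n -> 'cV[R]_p) (x : 'rV[R]_n) : 'M[R]_(p, n) :=
  \matrix_(i, j) 'D_(delta_mx 0 j) (fun y => f y i 0) x.

Lemma chain_scalar m n (u : 'rV[R]_m -> 'rV[R]_n) (f : 'rV[R]_n -> R) i :
  smooth_germ u -> u 0 = 0 -> sgerm f ->
  'D_(delta_mx 0 i) (fun x => f (u x)) 0 =
    \sum_j jac u 0 i j * 'D_(delta_mx 0 j) f 0.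
Proof.
move=> /smooth_germP[U [oU U0 Cu]] u0 [V [oV V0 Cf]].
have Vu0 : V (u 0) by rewrite u0.
have [_ E] := comp_diff i oU oV (Cu 1%N 0) (Cf 1%N) U0 Vu0.
transitivity ('D_(delta_mx 0 i) (f \o u) 0); first by [].
by rewrite E u0; apply: eq_bigr => j _; rewrite mxE mulrC.
Qed.

Lemma cjac_comp m n p (u : 'rV[R]_m -> 'rV[R]_n) (f : 'rV[R]_n -> 'cV[R]_p) :
  smooth_germ u -> u 0 = 0 -> smooth_germ f ->
  cjac (fun x => f (u x)) 0 = cjac f 0 *m (jac u 0)^T.
Proof.
move=> su u0 /smooth_germ_entry sf; apply/matrixP => i j; rewrite [LHS]mxE.
rewrite (chain_scalar j su u0 (sf i 0)) mxE; apply: eq_bigr => k _.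
by rewrite [cjac _ _ _ _]mxE [_^T _ _]mxE mulrC.
Qed.

Lemma jac_comp m n p (u : 'rV[R]_m -> 'rV[R]_n) (f : 'rV[R]_n -> 'rV[R]_p) :
  smooth_germ u -> u 0 = 0 -> smooth_germ f ->
  jac (fun x => f (u x)) 0 = jac u 0 *m jac f 0.
Proof.
move=> su u0 /smooth_germ_entry sf; apply/matrixP => i j; rewrite [LHS]mxE.
rewrite (chain_scalar i su u0 (sf 0 j)) [RHS]mxE; apply: eq_bigr => k _.
by rewrite [jac f _ _ _]mxE.
Qed.

Lemma jac_near m n (u v : 'rV[R]_m -> 'rV[R]_n) x :
  (\forall y \near x, u y = v y) -> jac u x = jac v x.
Proof.
move=> uv; apply/matrixP => i j; rewrite !mxE; apply: near_eq_derive.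
by apply: near_imp uv => y ->.
Qed.

Lemma cjac_near0 n p (f : 'rV[R]_n -> 'cV[R]_p) x :
  (\forall y \near x, f y = 0) -> cjac f x = 0.
Proof.
move=> f0; apply/matrixP => i j; rewrite !mxE -[RHS](derive_cst 0 x (delta_mx 0 j)).
by apply: near_eq_derive; apply: near_imp f0 => y ->; rewrite mxE.
Qed.

Lemma jac_linear m n (P : 'M[R]_(m, n)) x : jac (fun v => v *m P) x = P.
Proof.
apply/matrixP => i j; rewrite mxE.
have H : (fun h : R => h^-1 *: (((fun v : 'rV[R]_m => (v *m P) 0 j) \o shift x)
    (h *: delta_mx 0 i) - (x *m P) 0 j)) @ 0^' --> P i j.
  apply: (@cvg_trans _ ((fun=> P i j) @ (0 : R)^')); last exact: cvg_cst.
  apply: near_eq_cvg; apply: filterS (nbhs_dnbhs_neq (0 : R)) => h h0.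
  rewrite /= mulmxDl -scalemxAl -rowE; move: (x *m P) => X; rewrite !mxE addrK.
  by rewrite -[RHS]/(h^-1 * (h * P i j)) mulKf.
exact: cvg_lim H.
Qed.

Lemma jac_id n x : jac (fun v : 'rV[R]_n => v) x = 1%:M.
Proof.
rewrite -[RHS](jac_linear 1%:M x); congr (jac _ x); apply/funext => y.
by rewrite mulmx1.
Qed.

Lemma smooth_germ_diffE m n (u : 'rV[R]_m -> 'rV[R]_n) v :
  smooth_germ u -> 'd u 0 v = v *m jac u 0.
Proof.
by move=> /smooth_germP[U [oU U0 Cu]]; rewrite (row_diffE _ oU (Cu 1%N 0) U0).
Qed.

Lemma immersion_row_free m n (u : 'rV[R]_m -> 'rV[R]_n) :
  smooth_germ u -> injective ('d u (0 : 'rV[R]_m)) -> row_free (jac u 0).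
Proof.
move=> su iu; apply: inj_row_free => v vJ; apply: iu.
by rewrite !(smooth_germ_diffE _ su) vJ mul0mx.
Qed.

Lemma cjac_diffE n p (f : 'rV[R]_n -> 'cV[R]_p) i v : smooth_germ f ->
  'd (fun x => f x i 0 : R^o) (0 : 'rV[R]_n) v = (cjac f 0 *m v^T) i 0.
Proof.
move=> /smooth_germP[U [oU U0 Cf]].
have [_ E] := C1_diff oU (Cf 1%N i 0) U0.
by rewrite [LHS](congr1 (fun L => L v) E) /lform !mxE; apply: eq_bigr => j _; rewrite !mxE.
Qed.

Definition subfamily n r (I : {set 'I_r}) (h : 'rV[R]_n -> 'cV[R]_r) x : 'cV[R]_#|I| :=
  rowsub (@enum_val _ (mem I)) (h x).

Lemma lin_indep_row_free n r (h : 'rV[R]_n -> 'cV[R]_r) (I : {set 'I_r}) :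
  smooth_germ h -> lin_indep_differentials h I ->
  row_free (cjac (subfamily I h) 0).
Proof.
move=> sh li; apply: inj_row_free => v vJ.
(* [v] carried from positions in the enumeration of [I] to the indices themselves, and 0 outside
   [I]. *)
pose c i := \sum_k v 0 k * (@enum_val _ (mem I) k == i)%:R.
have cE k : c (enum_val k) = v 0 k.
  rewrite /c (bigD1 k)//= eqxx mulr1 big1 ?addr0// => k' /negbTE kk'.
  by rewrite (inj_eq enum_val_inj) kk' mulr0.
apply/rowP => k; rewrite mxE -cE; apply: (li c); last exact: enum_valP.
move=> x; rewrite big_enum_val/=.
transitivity ((v *m cjac (subfamily I h) 0 *m x^T) 0 0); last by rewrite vJ mul0mx mxE.
rewrite -mulmxA mxE; apply: eq_bigr => j _; rewrite cE cjac_diffE//.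
congr (_ * _); rewrite !mxE; apply: eq_bigr => a _; rewrite !mxE; congr (_ * _).
apply: (congr1 (fun f : 'rV[R]_n -> R => 'D_(delta_mx 0 a) f 0)).
by apply/funext => y; rewrite /subfamily mxE.
Qed.

Lemma diffeo_jac_unit n (Phi Psi : 'rV[R]_n -> 'rV[R]_n) : diffeo_germ Phi Psi ->
  jac Phi 0 \in unitmx /\ jac Psi 0 \in unitmx.
Proof.
move=> [[sPhi Phi0] [sPsi Psi0] PsiPhi _].
have : jac Phi 0 *m jac Psi 0 = 1%:M.
  by rewrite -(jac_comp sPhi Phi0 sPsi) -(jac_id 0); exact: jac_near.
exact: mulmx1_unit.
Qed.

(* Hadamard's lemma turns the increment of [(F, P)] into an invertible matrix
   applied to [v - u]. *)
Lemma difference_multiple m n k p l (F : 'rV[R]_n -> 'cV[R]_k) (P : 'M[R]_(n, p))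
    (S : 'M[R]_(n, k + p)) (u v : 'rV[R]_m -> 'rV[R]_n)
    (w : 'rV[R]_m -> 'cV[R]_l) (E : 'rV[R]_m -> 'M[R]_(k, l)) :
  smooth_germ F -> smooth_germ u -> smooth_germ v -> u 0 = 0 -> v 0 = 0 ->
  smooth_germ E -> S *m col_mx (cjac F 0) P^T = 1%:M ->
  (\forall x \near (0 : 'rV[R]_m), F (v x) - F (u x) = E x *m w x) ->
  (\forall x \near (0 : 'rV[R]_m), u x *m P = v x *m P) ->
  exists2 D : 'rV[R]_m -> 'M[R]_(n, l), smooth_germ D &
    \forall x \near (0 : 'rV[R]_m), (v x - u x)^T = D x *m w x.
Proof.
move=> sF su sv u0 v0 sE SE FE uvP.
have [Hd [sH HE H0]] := hadamard sF su sv u0 v0.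
have sQ : smooth_germ (fun x => S *m col_mx (Hd x) P^T).
  apply: smooth_germ_mul; first exact: smooth_germ_cst.
  apply/smooth_germ_entry => i j; case: (split_ordP i) => a ->.
    have := (smooth_germ_entry _).1 sH a j; apply: sgerm_eq => x.
    by rewrite col_mxEu.
  have := sgerm_cst m (P^T a j); apply: sgerm_eq => x.
  by rewrite col_mxEd.
have uQ : S *m col_mx (Hd 0) P^T \in unitmx.
  by rewrite H0 -/(cjac F 0) SE unitmx1.
have nQ := near_unitmx sQ uQ.
exists (fun x => invmx (S *m col_mx (Hd x) P^T) *m (S *m col_mx (E x) 0)).
  apply: smooth_germ_mul; first exact: smooth_germ_invmx.
  apply: smooth_germ_mul; first exact: smooth_germ_cst.
  apply/smooth_germ_entry => i j; case: (split_ordP i) => a ->.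
    have := (smooth_germ_entry _).1 sE a j; apply: sgerm_eq => x.
    by rewrite col_mxEu.
  have := sgerm_cst m (0 : R); apply: sgerm_eq => x.
  by rewrite col_mxEd mxE.
apply: near_imp2 (near_and nQ HE) (near_and FE uvP) => x [Qx Hx] [Fx Px].
rewrite -[RHS]mulmxA; apply: (canRL (mulKmx Qx)); rewrite -!mulmxA !mul_col_mx mul0mx -Fx Hx.
by rewrite -trmx_mul mulmxBl Px subrr trmx0.
Qed.

End jacobians.

(** * Reductions *)

Section reduction.
Context {R : realType}.

Lemma increasing_enum_inj s q (J : {set 'I_q}) (a : 'I_s -> 'I_q) :
  increasing_enum J a -> injective a.
Proof.
move=> [mono _] i j aij; apply: val_inj.
by case: (ltngtP i j) => // /mono; rewrite aij ltnn.
Qed.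

Lemma increasing_enum_card s q (J : {set 'I_q}) (a : 'I_s -> 'I_q) :
  increasing_enum J a -> #|J| = s.
Proof.
move=> ea; have -> : J = [set a i | i : 'I_s].
  apply/setP => j; apply/idP/imsetP => [/(ea.2 j)[i <-]|[i _ ->]]; first by exists i.
  by apply/(ea.2 _); exists i.
by rewrite card_imset ?card_ord//; exact: increasing_enum_inj ea.
Qed.

Lemma pos_diag_permE q (d : 'rV[R]_q) (s : 'S_q) i k :
  (diag_mx d *m perm_mx s) i k = d 0 i * (s i == k)%:R.
Proof. by rewrite mul_diag_mx !mxE. Qed.

Lemma pos_diag_perm_mulE q (d : 'rV[R]_q) (s : 'S_q) (v : 'cV[R]_q) i :
  (diag_mx d *m perm_mx s *m v) i 0 = d 0 i * v (s i) 0.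
Proof. by rewrite -mulmxA mul_diag_mx mxE -row_permE mxE. Qed.

Lemma sgerm_near_lt n (f : 'rV[R]_n -> R) : sgerm f -> f 0 < 0 ->
  \forall x \near (0 : 'rV[R]_n), f x < 0.
Proof.
move=> /sgerm_continuous cf f0.
have oN : open [set y : R | y < 0] by exact: (@open_lt R 0).
have nN : \forall y \near f 0, y < 0 by exact: open_nbhs_nbhs.
exact: (cf _ nN).
Qed.

Lemma sgerm_near_gt n (f : 'rV[R]_n -> R) : sgerm f -> 0 < f 0 ->
  \forall x \near (0 : 'rV[R]_n), 0 < f x.
Proof.
move=> sf f0; have := sgerm_near_lt (sgerm_opp sf); rewrite oppr_lt0 => /(_ f0).
by apply: near_imp => x; rewrite oppr_lt0.
Qed.

(** At 0 the term in [w] vanishes, so [sigma] pairs values of [g] and [g'] of the same sign. Indices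
    with a non-negative value lie in neither [K] nor [K'], hence survive in both reductions; pairing
    them by [sigma] gives a partial injection of the [s] kept positions, which extends to a
    permutation [tau]. *)
Lemma inequality_part m q s l (g g' : 'rV[R]_m -> 'cV[R]_q)
    (C : 'rV[R]_m -> 'M[R]_q) (B : 'rV[R]_m -> 'M[R]_(q, l)) (w : 'rV[R]_m -> 'cV[R]_l)
    (K K' : {set 'I_q}) (a a' : 'I_s -> 'I_q) :
  smooth_germ g -> smooth_germ g' -> smooth_germ C -> smooth_germ B -> w 0 = 0 ->
  (\forall x \near (0 : 'rV[R]_m), pos_diag_perm (C x) /\
     g x = C x *m g' x + B x *m w x) ->
  (forall j, j \in K -> g 0 j 0 < 0) -> (forall j, j \in K' -> g' 0 j 0 < 0) ->
  increasing_enum (~: K)%SET a -> increasing_enum (~: K')%SET a' ->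
  exists (C1 : 'rV[R]_m -> 'M[R]_s) (B1 : 'rV[R]_m -> 'M[R]_(s, l)),
    [/\ smooth_germ C1, smooth_germ B1 &
      \forall x \near (0 : 'rV[R]_m), pos_diag_perm (C1 x) /\
        rowsub a (g x) = C1 x *m rowsub a' (g' x) + B1 x *m w x].
Proof.
move=> sg sg' sC sB w0 gE gK gK' ea ea'.
have [[d [sigma [d0 C0E]]] g0E] := nbhs_singleton gE.
have C0 i k : C 0 i k = d 0 i * (sigma i == k)%:R by rewrite C0E pos_diag_permE.
have g0 i : g 0 i 0 = d 0 i * g' 0 (sigma i) 0.
  by rewrite g0E w0 mulmx0 addr0 C0E pos_diag_perm_mulE.
have g0lt i : (g 0 i 0 < 0) = (g' 0 (sigma i) 0 < 0) by rewrite g0 pmulr_rlt0.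
(* The permutation hidden in [pos_diag_perm (C x)] might depend on [x]. Its entries at the positions
   of [sigma] remain positive near 0, which forces it to be [sigma] there. *)
have nC : \forall x \near (0 : 'rV[R]_m), forall i, 0 < C x i (sigma i).
  apply: near_forall => i; apply: sgerm_near_gt; first exact: (smooth_germ_entry _).1 sC i _.
  by rewrite C0 eqxx mulr1.
pose A := [set j : 'I_s | ~~ (g 0 (a j) 0 < 0)]%SET.
have exf j : exists j', j \in A -> a' j' = sigma (a j).
  have [jA|_] := boolP (j \in A); last by exists j.
  have /(ea'.2 _).1[j' <-] : sigma (a j) \in (~: K')%SET.
    by rewrite inE; apply: contraL jA => /gK'; rewrite inE negbK g0lt.
  by exists j'.
pose f j := projT1 (cid (exf j)).
have fE j : j \in A -> a' (f j) = sigma (a j) by exact: (projT2 (cid (exf j))).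
have fA : {in A &, injective f}.
  move=> i j iA jA fij; apply: (increasing_enum_inj ea); apply: (@perm_inj _ sigma).
  by rewrite -!fE// fij.
have [tau tauE] := perm_extension fA.
have a'A j : j \in A -> a' (tau j) = sigma (a j) by move=> jA; rewrite tauE// fE.
(* A non-negative value of [g'] at [a' (tau j)] pulls back under [sigma] to a kept non-negative
   index [a i], and then [tau i = tau j]. So the pairs left over are negative on both sides. *)
have a'nA j : j \notin A -> g' 0 (a' (tau j)) 0 < 0.
  apply: contraNT => gt.
  have ge : ~~ (g 0 (sigma^-1%g (a' (tau j))) 0 < 0) by rewrite g0lt permKV.
  have /(ea.2 _).1[i ai] : sigma^-1%g (a' (tau j)) \in (~: K)%SET.
    by rewrite inE; apply: contra ge => /gK.
  have iA : i \in A by rewrite inE ai.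
  have := a'A i iA; rewrite ai permKV => /(increasing_enum_inj ea')/perm_inj <-.
  exact: iA.
(* Off [A] the quotient of two negative germs is smooth and positive, and it already gives exact
   equality; hence the zero rows of [B1]. *)
pose D x j := if j \in A then C x (a j) (sigma (a j))
              else g x (a j) 0 / g' x (a' (tau j)) 0.
pose C1 x := diag_mx (\row_j D x j) *m perm_mx tau.
pose B1 x := \matrix_(j < s, k < l) (if j \in A then B x (a j) k else 0).
have sgC := (smooth_germ_entry _).1 sC; have sgB := (smooth_germ_entry _).1 sB.
have sgg := (smooth_germ_entry _).1 sg; have sgg' := (smooth_germ_entry _).1 sg'.
have sD j : sgerm (fun x => D x j).
  rewrite /D; have [jA|jA] := boolP (j \in A); first exact: (sgC (a j) (sigma (a j))).
  apply: sgerm_mul; first exact: (sgg (a j) 0).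
  have gn0 : g' 0 (a' (tau j)) 0 != 0 by rewrite lt_eqF// a'nA.
  exact: (sgerm_inv gn0 (sgg' (a' (tau j)) 0)).
have ng : \forall x \near (0 : 'rV[R]_m), forall j, j \notin A -> g x (a j) 0 < 0.
  apply: near_forall => j; have [jA|jA] := boolP (j \in A).
    by apply: near_imp gE => x _ /negP.
  have gaj : g 0 (a j) 0 < 0 by move: jA; rewrite inE negbK.
  by apply: near_imp (sgerm_near_lt (sgg (a j) 0) gaj).
have ng' : \forall x \near (0 : 'rV[R]_m), forall j, j \notin A -> g' x (a' (tau j)) 0 < 0.
  apply: near_forall => j; have [jA|jA] := boolP (j \in A).
    by apply: near_imp gE => x _ /negP.
  by apply: near_imp (sgerm_near_lt (sgg' (a' (tau j)) 0) (a'nA j jA)).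
exists C1, B1; split.
- apply/smooth_germ_entry => i k.
  apply: (@sgerm_eq _ _ (fun x => D x i * (tau i == k)%:R)).
    by move=> x; rewrite /C1 pos_diag_permE mxE.
  by apply: sgerm_mul => //; exact: sgerm_cst.
- apply/smooth_germ_entry => i k.
  apply: (@sgerm_eq _ _ (fun x => if i \in A then B x (a i) k else 0)).
    by move=> x; rewrite mxE.
  by have [jA|jA] := boolP (i \in A); [exact: (sgB (a i) k)|exact: sgerm_cst].
- apply: near_imp2 (near_and gE nC) (near_and ng ng') => x.
  move=> [[[e [sg0 [e0 CE]]] gxE] Cp] [gx gx'].
  split.
    exists (\row_j D x j), tau; split=> // j; rewrite mxE /D.
    case: ifPn => jA; first exact: Cp.
    by rewrite nmulr_rgt0 ?gx// invr_lt0 gx'.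
  apply/matrixP => j k; rewrite (ord1 k) mxE [RHS]mxE /C1 pos_diag_perm_mulE.
  rewrite [(\row_j D x j) 0 j]mxE [rowsub a' _ _ _]mxE /D.
  case: ifPn => jA; last first.
    rewrite divfK ?lt_eqF ?gx'// [X in _ + X](_ : _ = 0) ?addr0//.
    by rewrite mxE big1// => i _; rewrite mxE (negbTE jA) mul0r.
  rewrite gxE mxE; congr (_ + _).
    rewrite CE pos_diag_perm_mulE pos_diag_permE a'A//.
    have : 0 < C x (a j) (sigma (a j)) by exact: Cp.
    rewrite CE pos_diag_permE; case: eqP => [->|_]; first by rewrite mulr1.
    by rewrite mulr0 ltxx.
  by rewrite !mxE; apply: eq_bigr => i _; rewrite mxE jA.
Qed.

End reduction.

(** * Comparison of the two reductions *)

Section main.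
Context {R : realType}.

Lemma rowsubE p q l (b : 'I_p -> 'I_q) (A : 'M[R]_(q, l)) :
  rowsub b A = rowsub b 1%:M *m A.
Proof. by rewrite mul_rowsub_mx mul1mx. Qed.

Lemma smooth_germ_rowsub n p q l (b : 'I_p -> 'I_q) (M : 'rV[R]_n -> 'M[R]_(q, l)) :
  smooth_germ M -> smooth_germ (fun x => rowsub b (M x)).
Proof.
move=> /smooth_germ_entry sM; apply/smooth_germ_entry => i j.
by have := sM (b i) j; apply: sgerm_eq => x; rewrite mxE.
Qed.

Lemma smooth_germ_mulr m n p (u : 'rV[R]_m -> 'rV[R]_n) (P : 'M[R]_(n, p)) :
  smooth_germ u -> smooth_germ (fun x => u x *m P).
Proof. by move=> su; apply: smooth_germ_mul; [exact: su|exact: smooth_germ_cst]. Qed.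

Lemma jac_mulr m n p (u : 'rV[R]_m -> 'rV[R]_n) (P : 'M[R]_(n, p)) :
  smooth_germ u -> u 0 = 0 -> jac (fun x => u x *m P) 0 = jac u 0 *m P.
Proof.
move=> su u0; have sP : smooth_germ (fun v : 'rV[R]_n => v *m P).
  exact/smooth_germ_mulr/smooth_germ_id.
by rewrite (jac_comp su u0 sP) jac_linear.
Qed.

(** The shape of a change of charts: [F1] and [F2] have the same target, and exchanging their roles
    inverts the transition map. *)
Lemma diffeo_germ_comp n (F1 G1 F2 G2 : 'rV[R]_n -> 'rV[R]_n) :
  diffeo_germ F1 G1 -> diffeo_germ F2 G2 ->
  diffeo_germ (fun x => G1 (F2 x)) (fun x => G2 (F1 x)).
Proof.
move=> [[sF1 F10] [sG1 G10] GF1 FG1] [[sF2 F20] [sG2 G20] GF2 FG2]; split.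
- split; last by rewrite F20.
  exact: smooth_germ_comp.
- split; last by rewrite F10.
  exact: smooth_germ_comp.
- have := near_comp sF2 F20 FG1; apply: near_imp2 GF2 => x Hx Hy.
  by rewrite Hy.
- have := near_comp sF1 F10 FG2; apply: near_imp2 GF1 => x Hx Hy.
  by rewrite Hy.
Qed.

(** The transposed selection matrix puts the kept entries back in place and fills the positions in
    [I] with zeros. *)
Lemma enum_complement_expand r l (I : {set 'I_r}) (b : 'I_l -> 'I_r) (y : 'cV[R]_r) :
  increasing_enum (~: I)%SET b -> (forall i, i \in I -> y i 0 = 0) ->
  y = (rowsub b 1%:M)^T *m rowsub b y.
Proof.
move=> eb yI; apply/matrixP => i j; rewrite (ord1 j) mxE {j}.
have [iI|iI] := boolP (i \in I).
  rewrite yI// big1// => k _; rewrite !mxE.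
  have : b k \in (~: I)%SET by apply/(eb.2 _); exists k.
  by rewrite inE => bk; case: eqP => [E|]; rewrite ?mul0r//; rewrite E iI in bk.
have /(eb.2 _).1[k bk] : i \in (~: I)%SET by rewrite inE.
rewrite (bigD1 k)//= !mxE bk eqxx mul1r big1 ?addr0// => k' kk'.
by rewrite !mxE -bk (inj_eq (increasing_enum_inj eb)) (negbTE kk') mul0r.
Qed.

Lemma reduction_KG_equivalent n q r m s l
    (g : 'rV[R]_n -> 'cV[R]_q) (h : 'rV[R]_n -> 'cV[R]_r)
    (g' : 'rV[R]_n -> 'cV[R]_q) (h' : 'rV[R]_n -> 'cV[R]_r)
    (iota : 'rV[R]_m -> 'rV[R]_n) (I : {set 'I_r}) (K : {set 'I_q})
    (gr : 'rV[R]_m -> 'cV[R]_s) (hr : 'rV[R]_m -> 'cV[R]_l)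
    (iota' : 'rV[R]_m -> 'rV[R]_n) (I' : {set 'I_r}) (K' : {set 'I_q})
    (gr' : 'rV[R]_m -> 'cV[R]_s) (hr' : 'rV[R]_m -> 'cV[R]_l) :
  constraint_germ g h -> constraint_germ g' h' ->
  KG_equivalent g h g' h' ->
  is_reduction g h iota I K gr hr ->
  is_reduction g' h' iota' I' K' gr' hr' ->
  KG_equivalent gr hr gr' hr'.
Proof.
move=> [sg sh h0] [sg' sh' h'0] [Phi [Psi [C [B [A [dPP [sC sB sA] KG]]]]]].
move=> [gK liI mrnl [si i0 ii iZ _] [a [b [ea eb -> ->]]]].
move=> [g'K' liI' _ [si' i'0 ii' iZ' _] [a' [b' [ea' eb' -> ->]]]] {gr hr gr' hr'}.
have [[sPhi Phi0] [sPsi Psi0] PsiPhi PhiPsi] := dPP.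
have [uPhi uPsi] := diffeo_jac_unit dPP.
have mI : (m + #|I| = n)%N.
  have := cardsC I; rewrite (increasing_enum_card eb) card_ord => cI.
  by apply/eqP; rewrite -(eqn_add2r l) -addnA cI mrnl.
have mI' : (m + #|I'| = n)%N.
  have := cardsC I'; rewrite (increasing_enum_card eb') card_ord => cI.
  by apply/eqP; rewrite -(eqn_add2r l) -addnA cI mrnl.
pose u x := Psi (iota x).
have su : smooth_germ u by exact: smooth_germ_comp.
have u0 : u 0 = 0 by rewrite /u i0.
have fu : row_free (jac u 0).
  rewrite (jac_comp si i0 sPsi) /row_free mxrankMfree ?row_free_unit//.
  exact: immersion_row_free.
have [P [uP iP]] := common_complement fu (immersion_row_free si' ii').
have [G1 dG1] : exists G1, diffeo_germ (fun x => u x *m P) G1.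
  apply: inverse_function; first exact: smooth_germ_mulr.
    by rewrite u0 mul0mx.
  by rewrite (jac_mulr _ su u0).
have [G2 dG2] : exists G2, diffeo_germ (fun x => iota' x *m P) G2.
  apply: inverse_function; first exact: smooth_germ_mulr.
    by rewrite i'0 mul0mx.
  by rewrite (jac_mulr _ si' i'0).
pose phi y := G1 (iota' y *m P); pose psi x := G2 (u x *m P).
have dphi : diffeo_germ phi psi := diffeo_germ_comp dG1 dG2.
have [_ [spsi psi0] _ _] := dphi.
pose v x := iota' (psi x).
have sv : smooth_germ v by exact: smooth_germ_comp.
have v0 : v 0 = 0 by rewrite /v psi0.
have uvP : \forall x \near (0 : 'rV[R]_m), v x *m P = u x *m P.
  have [[sF F0] _ _ _] := dG1; have [_ _ _ FG2] := dG2.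
  exact: near_comp sF F0 FG2.
pose hr x := rowsub b (h (iota x)); pose w x := rowsub b' (h' (v x)).
pose Eb : 'M[R]_(r, l) := (rowsub b 1%:M)^T.
pose Eb' : 'M[R]_(r, l) := (rowsub b' 1%:M)^T.
have hE : \forall x \near (0 : 'rV[R]_m), h (iota x) = Eb *m hr x.
  by apply: near_imp iZ => x Zx; exact: (enum_complement_expand eb Zx).
have h'E : \forall x \near (0 : 'rV[R]_m), h' (v x) = Eb' *m w x.
  apply: near_imp (near_comp spsi psi0 iZ') => x Zx.
  exact: (enum_complement_expand eb' Zx).
have KGi := near_comp si i0 KG.
have A0 : A 0 \in unitmx by have [] := nbhs_singleton KG.
have sAi : smooth_germ (fun x => A (iota x)) by exact: smooth_germ_comp.
have sAV : smooth_germ (fun x => invmx (A (iota x))).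
  by apply: smooth_germ_invmx; rewrite ?i0.
(* F = h' restricted to I' vanishes on v and is a multiple of hr on u. *)
have [D1 sD1 D1E] : exists2 D : 'rV[R]_m -> 'M[R]_(n, l), smooth_germ D &
    \forall x \near (0 : 'rV[R]_m), (v x - u x)^T = D x *m hr x.
  have sF : smooth_germ (subfamily I' h') by exact: smooth_germ_rowsub.
  have F0 : cjac (subfamily I' h') 0 *m (jac iota' 0)^T = 0.
    rewrite -(cjac_comp si' i'0 sF); apply: cjac_near0.
    apply: near_imp iZ' => y Zy; apply/matrixP => i j; rewrite !mxE (ord1 j).
    by apply: Zy; exact: enum_valP.
  have [S SE] := complement_left_inverse (lin_indep_row_free sh' liI') F0 iP mI'.
  apply: (difference_multiple (F := subfamily I' h') (P := P) (S := S)
    (E := fun x => - (rowsub (@enum_val _ (mem I')) 1%:M *m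
                        (invmx (A (iota x)) *m Eb)))) => //.
    apply: smooth_germ_opp; apply: smooth_germ_mul; first exact: smooth_germ_cst.
    by apply: smooth_germ_mul => //; exact: smooth_germ_cst.
    have N1 := near_comp spsi psi0 iZ'.
    apply: near_imp3 N1 KGi hE => x Zx [_ uA _ hA] hx.
    have -> : subfamily I' h' (v x) = 0.
      apply/matrixP => i j; rewrite !mxE (ord1 j).
      by apply: Zx; exact: enum_valP.
    rewrite sub0r /subfamily rowsubE mulNmx -!mulmxA -hx hA mulKmx//.
  by apply: near_imp uvP => x ->.
(* F = h restricted to I, composed with Phi, vanishes on u and is a multiple of
   w on v. *)
have [D2 sD2 D2E] : exists2 D : 'rV[R]_m -> 'M[R]_(n, l), smooth_germ D &
    \forall x \near (0 : 'rV[R]_m), (v x - u x)^T = D x *m w x.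
  pose F y := subfamily I h (Phi y).
  have sI : smooth_germ (subfamily I h) by exact: smooth_germ_rowsub.
  have sF : smooth_germ F by exact: smooth_germ_comp.
  have Fu : \forall x \near (0 : 'rV[R]_m), F (u x) = 0.
    apply: near_imp2 iZ (near_comp si i0 PhiPsi) => x Zx PPx.
    rewrite /F /u PPx; apply/matrixP => i j; rewrite !mxE (ord1 j).
    by apply: Zx; exact: enum_valP.
  have F0 : cjac F 0 *m (jac u 0)^T = 0.
    by rewrite -(cjac_comp su u0 sF); exact: cjac_near0.
  have fF : row_free (cjac F 0).
    rewrite (cjac_comp sPhi Phi0 sI) /row_free mxrankMfree.
      exact: lin_indep_row_free.
    by rewrite row_free_unit unitmx_tr.
  have [S SE] := complement_left_inverse fF F0 uP mI.
  have sPv : smooth_germ (fun x => Phi (v x)) by exact: smooth_germ_comp.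
  have Pv0 : Phi (v 0) = 0 by rewrite v0.
  apply: (difference_multiple (F := F) (P := P) (S := S)
    (E := fun x => rowsub (@enum_val _ (mem I)) 1%:M *m (A (Phi (v x)) *m Eb'))) => //.
    apply: smooth_germ_mul; first exact: smooth_germ_cst.
    apply: smooth_germ_mul; last exact: smooth_germ_cst.
    exact: (smooth_germ_comp sPv Pv0 sA).
    have N1 := near_comp sPv Pv0 KG.
    have N2 := near_comp sv v0 PsiPhi.
    apply: near_imp2 (near_and Fu h'E) (near_and N1 N2) => x [Fux hx] [[_ _ _ hA] PPx].
    rewrite Fux subr0 /F /subfamily rowsubE hA PPx hx -!mulmxA//.
  by apply: near_imp uvP => x ->.
have [Hh [sHh HhE _]] := hadamard sh' su sv u0 v0.
have [Hg [sHg HgE _]] := hadamard sg' su sv u0 v0.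
(* Both matrices come from [h' (v x) = h' (u x) + Hh x *m (v x - u x)^T]. To obtain [w] from [hr]
   the difference is written with [D1]; to obtain [hr] from [w], with [D2]. *)
pose M1 x := rowsub b' 1%:M *m (invmx (A (iota x)) *m Eb + Hh x *m D1 x).
pose M2 x := rowsub b 1%:M *m (A (iota x) *m (Eb' - Hh x *m D2 x)).
have sM1 : smooth_germ M1.
  apply: smooth_germ_mul; first exact: smooth_germ_cst.
  apply: smooth_germ_add; apply: smooth_germ_mul => //; exact: smooth_germ_cst.
have sM2 : smooth_germ M2.
  apply: smooth_germ_mul; first exact: smooth_germ_cst.
  apply: smooth_germ_mul => //; apply: smooth_germ_add; first exact: smooth_germ_cst.
  by apply: smooth_germ_opp; exact: smooth_germ_mul.
have h'uE : \forall x \near (0 : 'rV[R]_m), h' (u x) = (Eb' - Hh x *m D2 x) *m w x.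
  apply: near_imp3 h'E HhE D2E => x hx Hx Dx.
  by rewrite mulmxBl -hx -mulmxA -Dx -Hx subKr.
have wE : \forall x \near (0 : 'rV[R]_m), w x = M1 x *m hr x.
  apply: near_imp2 (near_and hE KGi) (near_and HhE D1E) => x [hx [_ uA _ hA]] [Hx Dx].
  rewrite -mulmxA mulmxDl -!mulmxA -hx -Dx -Hx hA mulKmx// -/(u x).
  by rewrite [h' (u x) + _]addrC subrK -rowsubE.
have hrE : \forall x \near (0 : 'rV[R]_m), hr x = M2 x *m w x.
  apply: near_imp2 KGi h'uE => x [_ uA _ hA] hu.
  by rewrite -!mulmxA -hu /hr hA -rowsubE.
have [S uS] := unit_completion (M2 0) (M1 0).
pose A1 x := M2 x + S *m (1%:M - M1 x *m M2 x).
have sA1 : smooth_germ A1.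
  apply: smooth_germ_add; first exact: sM2.
  apply: smooth_germ_mul; first exact: smooth_germ_cst.
  apply: smooth_germ_add; first exact: smooth_germ_cst.
  by apply: smooth_germ_opp; apply: smooth_germ_mul; [exact: sM1|exact: sM2].
have nA1 := near_unitmx sA1 uS.
have w0 : w 0 = 0 by rewrite /w v0 h'0; apply/matrixP => i j; rewrite !mxE.
(* Collects the coefficients of [w] after substituting [h' (u x) = (Eb' - Hh x *m D2 x) *m w x] and
   [g' (u x) = g' (v x) - Hg x *m D2 x *m w x] into the given equivalence at [iota x]. *)
pose B1 x := B (iota x) *m (Eb' - Hh x *m D2 x) - C (iota x) *m (Hg x *m D2 x).
have sB1 : smooth_germ B1.
  apply: smooth_germ_add.
    apply: smooth_germ_mul; first exact: smooth_germ_comp.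
    apply: smooth_germ_add; first exact: smooth_germ_cst.
    by apply: smooth_germ_opp; exact: smooth_germ_mul.
  apply: smooth_germ_opp; apply: smooth_germ_mul; first exact: smooth_germ_comp.
  exact: smooth_germ_mul.
have gE : \forall x \near (0 : 'rV[R]_m), pos_diag_perm (C (iota x)) /\
    g (iota x) = C (iota x) *m g' (v x) + B1 x *m w x.
  apply: near_imp2 (near_and KGi h'uE) (near_and HgE D2E) => x [[pC _ gx _] hu] [Hx Dx].
  have guE : g' (u x) = g' (v x) - Hg x *m (D2 x *m w x) by rewrite -Dx -Hx subKr.
  split=> //; rewrite gx -/(u x) hu guE /B1 mulmxBr [in RHS]mulmxBl -!mulmxA.
  by rewrite [LHS]addrAC -[LHS]addrA.
have sgi : smooth_germ (fun x => g (iota x)) by exact: smooth_germ_comp.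
have sg'v : smooth_germ (fun x => g' (v x)) by exact: smooth_germ_comp.
have sCi : smooth_germ (fun x => C (iota x)) by exact: smooth_germ_comp.
have gK0 j : j \in K -> g (iota 0) j 0 < 0 by rewrite i0; exact: gK.
have g'K0 j : j \in K' -> g' (v 0) j 0 < 0 by rewrite v0; exact: g'K'.
have [C2 [B2 [sC2 sB2 gE2]]] := inequality_part sgi sg'v sCi sB1 w0 gE gK0 g'K0 ea ea'.
exists phi, psi, C2, B2, A1; split=> //.
apply: near_imp2 (near_and gE2 nA1) (near_and wE hrE) => x [[pC gx] uA] [wx hx].
split=> //.
rewrite /A1 mulmxDl -hx -mulmxA mulmxBl mul1mx -mulmxA -hx -wx subrr mulmx0 addr0.
by [].
Qed.

End main.

Theorem lemma2p3 (R : realType) (n q r : nat)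
    (g : 'rV[R]_n -> 'cV[R]_q) (h : 'rV[R]_n -> 'cV[R]_r)
    (g' : 'rV[R]_n -> 'cV[R]_q) (h' : 'rV[R]_n -> 'cV[R]_r) :
  constraint_germ g h -> constraint_germ g' h' ->
  nonempty_set_germ (feasible_set g h) ->
  nonempty_set_germ (feasible_set g' h') ->
  finitely_KG_determined g h -> finitely_KG_determined g' h' ->
  KG_equivalent g h g' h' ->
  forall (m s l : nat)
    (iota : 'rV[R]_m -> 'rV[R]_n) (I : {set 'I_r}) (K : {set 'I_q})
    (gr : 'rV[R]_m -> 'cV[R]_s) (hr : 'rV[R]_m -> 'cV[R]_l)
    (iota' : 'rV[R]_m -> 'rV[R]_n) (I' : {set 'I_r}) (K' : {set 'I_q})
    (gr' : 'rV[R]_m -> 'cV[R]_s) (hr' : 'rV[R]_m -> 'cV[R]_l),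
  is_reduction g h iota I K gr hr ->
  is_reduction g' h' iota' I' K' gr' hr' ->
  KG_equivalent gr hr gr' hr'.
Proof.
move=> cg cg' _ _ _ _ KG m s l iota I K gr hr iota' I' K' gr' hr'.
exact: reduction_KG_equivalent.
Qed.
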